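(* Let $n\ge 3$. The monoid $C_n$ has a chain of ideals $$\emptyset=I_{n-2}\vartriangleleft I_{n-3}\vartriangleleft\cdots\vartriangleleft I_0\vartriangleleft I_{-1}\vartriangleleft C_n$$ with the following properties: 1. for $i=0,\ldots,n-2$ the semigroup $M_i$ is a semigroup of matrix type, $M_i\cong\mathcal{M}^0(S_i,A_i,B_i;P_i)$, such that $M_i\subseteq I_{i-1}/I_i$, where $S_i$ is the cyclic semigroup generated by $x_nq_i$ and $P_i$ is a square matrix of size $B_i\times A_i$ with coefficients in $\langle x_nq_i\rangle\cup\{\theta\}$ that is symmetric (when $B_i$ is ordered correspondingly to $A_i$ via the bijection $\chi_i:A_i\to B_i$); 2. for $i=1,\ldots,n-2$ the sets $(I_{i-1}/I_i)\setminus M_i$ are finite; 3. $I_{-1}/I_0=M_0$; 4. $\tilde M_{n-2}=M_{n-2}\setminus\{\theta\}$ is an ideal of $C_n$; 5. $C_n/I_{-1}$ is a finite semigroup.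
   Context: For $n\ge 3$, $C_n$ is the monoid generated by $x_1,\dots,x_n$ with relations (indices modulo $n$) $x_i^2=x_i$; $x_ix_j=x_jx_i$ if $i,j$ are distinct and not cyclically adjacent; $x_ix_{i+1}x_i=x_{i+1}x_ix_{i+1}=x_ix_{i+1}$. $F$ is the free monoid on $x_1,\dots,x_n$ with the deg-lex order induced by $x_1<\cdots<x_n$. Each element of $C_n$ is identified with its reduced form, i.e. the deg-lex smallest word in $F$ representing it. For indices $i,j$, $x_i\cdots x_j$ denotes the product of consecutive generators, increasing if $i\le j$ and decreasing if $i>j$. For $0\le i\le n-2$ let $q_i=x_1\cdots x_i\,x_{n-1}\cdots x_{i+1}$ ($q_0=x_{n-1}\cdots x_1$). $\langle x_nq_i\rangle$ is the submonoid of $C_n$ generated by $x_nq_i$. Ideals: $I_i=\{w\in C_n: C_nwC_n\cap\langle x_nq_i\rangle=\emptyset\}$ for $0\le i\le n-2$, and $I_{-1}=I_0\cup C_nx_nq_0C_n$. For ideals $I\subseteq J$, $J/I=(J\setminus I)\cup\{\theta\}$ is the Rees factor semigroup; for $I=\emptyset$ one puts $J/\emptyset=J^0$, $J$ with a zero $\theta$ adjoined. Sets: $A_i$ is the set of all suffixes (including the empty word and the full word) of words $(x_{k_s}\cdots x_s)(x_{k_{s+1}}\cdots x_{s+1})\cdots(x_{k_{i+1}}\cdots x_{i+1})$, where $s\in\{0,\dots,i+1\}$, $k_{s+1}<\cdots<k_{i+1}\le n-1$, $k_q>q$ for $q=s+1,\dots,i+1$, and $1\le k_s\le s$ (for $s=0$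 the first block is omitted; for $s=i+1$ the word is $x_{k_{i+1}}\cdots x_{i+1}$ with $1\le k_{i+1}\le i+1$). $B_i$ is the set of all prefixes (including the empty word and the full word) of words of two kinds, $r\ge0$: (a) $x_n(x_1\cdots x_{i_1}x_{n-1}\cdots x_{j_1})\cdots x_n(x_1\cdots x_{i_r}x_{n-1}\cdots x_{j_r})x_nx_{n-1}\cdots x_{j_{r+1}}$ with $1\le i_r<\cdots<i_1<i+1<j_1<\cdots<j_{r+1}\le n$ (the last block is just $x_n$ if $j_{r+1}=n$); (b) $x_n(x_1\cdots x_{i_1}x_{n-1}\cdots x_{j_1})\cdots x_n(x_1\cdots x_{i_r}x_{n-1}\cdots x_{j_r})x_nx_1\cdots x_{i_{r+1}}$ with $1\le i_{r+1}<i_r<\cdots<i_1<i+1<j_1<\cdots<j_r\le n-1$. $\tilde M_i=\{a(x_nq_i)^kb: a\in A_i,b\in B_i,k\ge1\}\subseteq C_n$ (these words are reduced, and they are exactly the reduced words with a factor $x_nq_i$). $M_i=\tilde M_i\cup\{\theta\}$, where $\theta$ is a zero and the product of $u,w\in\tilde M_i$ is the product $uw$ in $C_n$ if $uw\notin I_i$, and $\theta$ if $uw\in I_i$. Involutions: $\tau$ is the anti-automorphism of $C_n$ with $\tau(x_i)=x_{n-i}$ for $i\ne n$, $\tau(x_n)=x_n$; $\sigma$ is the automorphism with $\sigma(x_i)=x_{i+1}$ ($x_{n+1}=x_1$); $\chi_i=\sigma^{i+1}\tau$, which restricts to a bijection $A_i\to B_i$ (as subsets of $C_n$). Matrix type: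 for a semigroup $S$, nonempty sets $A,B$ and a $B\times A$ matrix $P=(p_{ba})$ with entries in $S^1\cup\{\theta\}$, $\mathcal M^0(S,A,B;P)$ is the set of triples $(s,a,b)$, $s\in S,a\in A,b\in B$, together with a zero $\theta$, with $(s,a,b)(s',a',b')=(sp_{ba'}s',a,b')$ if $p_{ba'}\ne\theta$, and $\theta$ otherwise. *)

(* Defs.v *)
From HB Require Import structures.
From mathcomp Require Import all_boot all_algebra.
From mathcomp Require Import all_classical.

Set Implicit Arguments.
Unset Strict Implicit.
Unset Printing Implicit Defensive.

Local Open Scope classical_set_scope.
Local Open Scope quotient_scope.

(* Letters are indexed by 'Z_n, the integers modulo n (n >= 2): the generator
   x_k, 1 <= k <= n, is the letter k%:R, so that x_n is the letter 0 and
   "indices modulo n" is arithmetic in 'Z_n. *)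
Inductive hk_rel (n : nat) : seq 'Z_n -> seq 'Z_n -> Prop :=
| hk_idem i : hk_rel [:: i; i] [:: i]
| hk_comm i j : i != j -> j != (i + 1)%R -> i != (j + 1)%R ->
    hk_rel [:: i; j] [:: j; i]
| hk_braid1 i : hk_rel [:: i; (i + 1)%R; i] [:: i; (i + 1)%R]
| hk_braid2 i : hk_rel [:: (i + 1)%R; i; (i + 1)%R] [:: i; (i + 1)%R].

Inductive hk_cong (n : nat) : seq 'Z_n -> seq 'Z_n -> Prop :=
| hk_base u v : hk_rel u v -> hk_cong u v
| hk_refl u : hk_cong u u
| hk_sym u v : hk_cong u v -> hk_cong v u
| hk_trans v u w : hk_cong u v -> hk_cong v w -> hk_cong u w
| hk_cat u u' v v' : hk_cong u u' -> hk_cong v v' -> hk_cong (u ++ v) (u' ++ v').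

Definition hk_eqv (n : nat) : rel (seq 'Z_n) := fun u v => `[< hk_cong u v >].

Lemma hk_eqv_refl n : reflexive (@hk_eqv n).
Proof. by move=> u; apply/asboolP/hk_refl. Qed.

Lemma hk_eqv_sym n : symmetric (@hk_eqv n).
Proof. by move=> u v; apply/asboolP/asboolP => /hk_sym. Qed.

Lemma hk_eqv_trans n : transitive (@hk_eqv n).
Proof. by move=> v u w /asboolP uv /asboolP vw; apply/asboolP/(hk_trans uv). Qed.

Canonical hk_equiv n :=
  EquivRel (@hk_eqv n) (@hk_eqv_refl n) (@hk_eqv_sym n) (@hk_eqv_trans n).

Definition Cn (n : nat) := {eq_quot @hk_eqv n}.

HB.instance Definition _ n := Choice.on (Cn n).
HB.instance Definition _ n := EqQuotient.on (Cn n).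

Lemma Cn_eqP n (u v : seq 'Z_n) : \pi_(Cn n) u = \pi_(Cn n) v <-> hk_cong u v.
Proof.
split=> [/eqmodP/asboolP//|uv].
by apply/eqmodP/asboolP.
Qed.

Lemma Cn_ind n (P : Cn n -> Prop) :
  (forall u, P (\pi_(Cn n) u)) -> forall c, P c.
Proof. by move=> Pu c; rewrite -[c]reprK. Qed.

Lemma Cn_reprP n (u : seq 'Z_n) : hk_cong (repr (\pi_(Cn n) u)) u.
Proof. by apply/Cn_eqP; rewrite reprK. Qed.

Definition Cn_mul n (a b : Cn n) : Cn n := \pi_(Cn n) (repr a ++ repr b).

Lemma Cn_mul_pi n (u v : seq 'Z_n) :
  Cn_mul (\pi_(Cn n) u) (\pi_(Cn n) v) = \pi_(Cn n) (u ++ v).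
Proof. by apply/Cn_eqP/hk_cat; apply: Cn_reprP. Qed.

Lemma Cn_mulA n : associative (@Cn_mul n).
Proof.
move=> a b c; elim/Cn_ind: a => u; elim/Cn_ind: b => v; elim/Cn_ind: c => w.
by rewrite !Cn_mul_pi catA.
Qed.

Lemma Cn_mul1 n : left_id (\pi_(Cn n) [::]) (@Cn_mul n).
Proof. by move=> a; elim/Cn_ind: a => u; rewrite Cn_mul_pi. Qed.

Lemma Cn_1mul n : right_id (\pi_(Cn n) [::]) (@Cn_mul n).
Proof. by move=> a; elim/Cn_ind: a => u; rewrite Cn_mul_pi cats0. Qed.

HB.instance Definition _ n :=
  isMonoid.Build (Cn n) (@Cn_mulA n) (@Cn_mul1 n) (@Cn_1mul n).

(* The element x_{k_1} ... x_{k_m} of C_n, for a list of indices in 1..n. *)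
Definition elt (n : nat) (w : seq nat) : Cn n :=
  \pi_(Cn n) [seq (k%:R)%R : 'Z_n | k <- w].

Lemma elt_cat n u v : elt n (u ++ v) = (elt n u * elt n v)%g.
Proof. by rewrite /elt map_cat -Cn_mul_pi. Qed.

Definition sigma (n : nat) (c : Cn n) : Cn n :=
  \pi_(Cn n) [seq (i + 1)%R | i <- repr c].

(* x_i |-> x_{n-i} and x_n |-> x_n is negation of the index in 'Z_n. *)
Definition tau (n : nat) (c : Cn n) : Cn n :=
  \pi_(Cn n) (rev [seq (- i)%R | i <- repr c]).

Definition chi (n i : nat) (c : Cn n) : Cn n := iter i.+1 (@sigma n) (tau c).

Lemma sigma_pi n (u : seq 'Z_n) :
  sigma (\pi_(Cn n) u) = \pi_(Cn n) [seq (i + 1)%R | i <- u].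
Proof.
apply/Cn_eqP.
have := Cn_reprP u; move: (repr _) => r.
elim=> {r u} [u v|u|u v _ IH|v u w _ IH1 _ IH2|u u' v v' _ IH1 _ IH2].
- case=> [i|i j ij ji1 ij1|i|i] /=; apply: hk_base.
  + exact: hk_idem.
  + by apply: hk_comm; rewrite (inj_eq (GRing.addIr _)).
  + exact: hk_braid1.
  + exact: hk_braid2.
- exact: hk_refl.
- exact: hk_sym.
- exact: hk_trans IH1 IH2.
- by rewrite !map_cat; apply: hk_cat.
Qed.

Lemma tau_pi n (u : seq 'Z_n) :
  tau (\pi_(Cn n) u) = \pi_(Cn n) (rev [seq (- i)%R | i <- u]).
Proof.
have oppS (i : 'Z_n) : (- i)%R = (- (i + 1) + 1)%R.
  by rewrite GRing.opprD GRing.addrNK.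
apply/Cn_eqP.
have := Cn_reprP u; move: (repr _) => r.
elim=> {r u} [u v|u|u v _ IH|v u w _ IH1 _ IH2|u u' v v' _ IH1 _ IH2].
- case=> [i|i j ij ji1 ij1|i|i]; rewrite /rev /=; apply: hk_base.
  + exact: hk_idem.
  + have opp1 (a b : 'Z_n) : b != (a + 1)%R -> (- a)%R != (- b + 1)%R.
      by rewrite (oppS a) (inj_eq (GRing.addIr _)) (inj_eq GRing.oppr_inj) eq_sym.
    by apply: hk_comm; [rewrite (inj_eq GRing.oppr_inj) eq_sym|exact: opp1..].
  + by rewrite (oppS i); apply: hk_braid2.
  + by rewrite (oppS i); apply: hk_braid1.
- exact: hk_refl.
- exact: hk_sym.
- exact: hk_trans IH1 IH2.
- by rewrite !map_cat !rev_cat; apply: hk_cat.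
Qed.

Lemma sigmaM n (a b : Cn n) : sigma (a * b)%g = (sigma a * sigma b)%g.
Proof.
elim/Cn_ind: a => u; elim/Cn_ind: b => v.
by rewrite [(_ * _)%g]Cn_mul_pi !sigma_pi map_cat [RHS]Cn_mul_pi.
Qed.

Lemma tauM n (a b : Cn n) : tau (a * b)%g = (tau b * tau a)%g.
Proof.
elim/Cn_ind: a => u; elim/Cn_ind: b => v.
by rewrite [(_ * _)%g]Cn_mul_pi !tau_pi map_cat rev_cat [RHS]Cn_mul_pi.
Qed.

(* The indices of x_a ... x_b, increasing (empty when a > b) and decreasing
   (empty when a < b). *)
Definition up (a b : nat) : seq nat := iota a (b.+1 - a).
Definition down (a b : nat) : seq nat := rev (up b a).

Definition qword (n i : nat) : seq nat := up 1 i ++ down n.-1 i.+1.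

Definition xq (n i : nat) : Cn n := elt n (n :: qword n i).

Definition powers {T : monoidType} (x : T) : set T :=
  [set (x ^+ k)%g | k in [set: nat]].

Definition pos_powers {T : monoidType} (x : T) : set T :=
  [set (x ^+ k)%g | k in [set k | 1 <= k]].

Definition two_sided {T : monoidType} (w : T) : set T :=
  [set c | exists u v : T, c = (u * w * v)%g].

Definition ideal_of {T : monoidType} (I J : set T) : Prop :=
  I `<=` J /\ forall x y, J x -> I y -> I (x * y)%g /\ I (y * x)%g.

Definition Iset (n i : nat) : set (Cn n) :=
  [set w | two_sided w `&` powers (xq n i) = set0].
Arguments Iset : clear implicits.

Definition Iset_m1 (n : nat) : set (Cn n) := Iset n 0 `|` two_sided (xq n 0).
Arguments Iset_m1 : clear implicits.

(* I_{i-1} *)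
Definition Iset_pred (n i : nat) : set (Cn n) :=
  if i is j.+1 then Iset n j else Iset_m1 n.
Arguments Iset_pred : clear implicits.

(* A zero theta is adjoined to a type as None. *)
Definition adj0 {T : Type} (X : set T) : set (option T) := None |` Some @` X.

(* J/I is the set (rees J I) with the product (rees_mul I). *)
Definition rees {T : monoidType} (J I : set T) : set (option T) :=
  adj0 (J `\` I).

Definition rees_mul {T : monoidType} (I : set T) (x y : option T) : option T :=
  match x, y with
  | Some u, Some w => if `[< I (u * w)%g >] then None else Some (u * w)%g
  | _, _ => None
  end.

Definition is_semigroup {T : Type} (X : set T) (mul : T -> T -> T) : Prop :=
  (forall x y, X x -> X y -> X (mul x y)) /\
  (forall x y z, X x -> X y -> X z -> mul x (mul y z) = mul (mul x y) z).

Definition semigroup_iso {T U : Type} (X : set T) (mulX : T -> T -> T)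
    (Y : set U) (mulY : U -> U -> U) : Prop :=
  exists f : T -> U, set_bij X Y f /\
    forall x y, X x -> X y -> f (mulX x y) = mulY (f x) (f y).

(* M^0(S, A, B; P) for a subsemigroup S of a monoid T, where S^1 is S together
   with the identity of T; P takes its values in S^1 and theta = None, and only
   its values on B x A matter. *)
Definition matrix_type {T : monoidType} {U V : Type}
    (S : set T) (A : set U) (B : set V) : set (option (T * U * V)) :=
  adj0 (S `*` A `*` B).

Definition matrix_mul {T : monoidType} {U V : Type} (P : V -> U -> option T)
    (x y : option (T * U * V)) : option (T * U * V) :=
  match x, y with
  | Some (s, a, b), Some (s', a', b') =>
      if P b a' is Some p then Some ((s * p * s')%g, a, b') else None
  | _, _ => None
  end.

Definition A_valid (n i s : nat) (k : nat -> nat) : Prop :=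
  [/\ s <= i.+1,
      0 < s -> 1 <= k s <= s,
      forall q, s < q -> q <= i.+1 -> q < k q,
      forall q, s < q -> q < i.+1 -> k q < k q.+1 &
      s < i.+1 -> k i.+1 <= n.-1].

Definition A_word (i s : nat) (k : nat -> nat) : seq nat :=
  (if 0 < s then up (k s) s else [::]) ++
  flatten [seq down (k q) q | q <- iota s.+1 (i.+1 - s)].

Definition Aset (n i : nat) : set (Cn n) :=
  [set c | exists s k w,
     [/\ A_valid n i s k, suffix w (A_word i s k) & c = elt n w]].
Arguments Aset : clear implicits.

(* The blocks x_n (x_1 ... x_{i_l} x_{n-1} ... x_{j_l}) for si = i_1, ..., i_r
   and sj = j_1, ..., j_r. *)
Definition B_blocks (n : nat) (si sj : seq nat) : seq nat :=
  flatten [seq n :: up 1 p.1 ++ down n.-1 p.2 | p <- zip si sj].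

(* Words of kind (a), with j = j_{r+1}, and of kind (b), with i' = i_{r+1}. *)
Inductive B_word (n i : nat) : seq nat -> Prop :=
| B_word_a si sj j :
    size si = size sj -> all (leq 1) si -> path gtn i.+1 si ->
    path ltn i.+1 (rcons sj j) -> j <= n ->
    B_word n i (B_blocks n si sj ++ n :: down n.-1 j)
| B_word_b si sj i' :
    size si = size sj -> 1 <= i' -> path gtn i.+1 (rcons si i') ->
    path ltn i.+1 sj -> all (geq n.-1) sj ->
    B_word n i (B_blocks n si sj ++ n :: up 1 i').

Definition Bset (n i : nat) : set (Cn n) :=
  [set c | exists v w, [/\ B_word n i v, prefix w v & c = elt n w]].
Arguments Bset : clear implicits.

Definition Mtilde (n i : nat) : set (Cn n) :=
  [set c | exists a b k,
     [/\ Aset n i a, Bset n i b, 1 <= k & c = (a * xq n i ^+ k * b)%g]].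
Arguments Mtilde : clear implicits.

(* The semigroup M_i is the set (Mset n i) with the product
   (rees_mul (Iset n i)). *)
Definition Mset (n i : nat) : set (option (Cn n)) := adj0 (Mtilde n i).
Arguments Mset : clear implicits.

(* Main.v *)
Require Import Defs.
From mathcomp Require Import all_boot all_algebra.
From mathcomp Require Import all_classical.
From mathcomp Require Import zify.

(** Read a word as instructions for a walker on the natural numbers: the letter
    x_k moves the walker from p to p + 1 if p = k modulo n, and leaves it in
    place otherwise.  The three families of relations preserve the resulting
    map, so every c in C_n acts by a nondecreasing map [act c] that commutes
    with the translation by n and satisfies p <= act c p.  This action is
    faithful ([walk_inj]): if c sends p + 1 and p + 2 to the same point but p
    to a smaller one, every word for c can be rewritten so as to start with
    x_{p+1}, with a strictly shorter rest whose map depends only on the map of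
    c ([hk_peel]); hence words with the same map are congruent, by induction
    on the length.  From then on, C_n is studied as a monoid of maps.

    Call rank of c the number of jumps of [act c] modulo n.  Rank does not
    increase under multiplication.  The generator x_n q_i has rank
    r = n - 1 - i: it sends each p to the first point after p of
    S = {p | p mod n is not in 1..i+1}, so its powers shift S along itself.
    A map of rank r is a composite E o (shift by k) o N, where N counts its
    jumps and E enumerates its image.  The words of A_i realise every counting
    map N exactly once ([Aset_ex], [gathers_inj]) and those of B_i every
    enumeration E of a window of length n exactly once ([Bset_ex],
    [spreads_inj]).  Taking E to start at its first point >= i + 2 gives the
    normal form a (x_n q_i)^k b, and k >= 1 says that act c 0 >= i + 2.  Thus

      M~_i = {c of rank r | act c 0 >= i + 2}     ([Mtilde_rank]),

    with unique normal forms ([nf_inj]).  An element of rank at least r can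
    be multiplied on the left and on the right into a power of x_n q_i
    ([rank_divides]), so I_i = {c | rank c < r} ([Iset_rank]).

    All assertions follow.  The ideals are nested because the bounds on ranks
    are.  Elements of I_{i-1} outside I_i and M~_i have rank r and
    act c 0 <= i + 1, so their maps are bounded and there are finitely many
    of them ([act_le_finite]); the same bound handles C_n / I_{-1}.  The sandwich
    entry of (b, a) is read off from x_n q_i b a x_n q_i, which either loses
    rank or is a power of x_n q_i with exponent at least 2 ([sandwich]).
    Finally chi_i is an involutive anti-automorphism that fixes x_n q_i; on
    maps it is the Galois adjoint seen in a mirror ([act_adj]).  It therefore
    exchanges A_i and B_i and makes the sandwich matrix symmetric. *)

Set Implicit Arguments.
Unset Strict Implicit.
Unset Printing Implicit Defensive.

Local Notation down := Defs.down.

(** * The faithful action on the natural numbers *)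

Definition res (n p : nat) : 'Z_n := (p%:R)%R.

Definition step (n : nat) (p : nat) (i : 'Z_n) : nat :=
  if res n p == i then p.+1 else p.

Definition walk (n : nat) (w : seq 'Z_n) (p : nat) : nat := foldl (@step n) p w.
Arguments walk : simpl never.

Section Walk.
Variable n : nat.
Hypothesis n_ge3 : 3 <= n.
Implicit Types (p q : nat) (i j : 'Z_n) (u v w : seq 'Z_n).

Local Notation res := (res n).
Local Notation walk := (@walk n).

Lemma resE p q : (res p == res q) = (p == q %[mod n]).
Proof. by rewrite -val_eqE /= !val_Zp_nat //; lia. Qed.

Lemma res_near p q : p < q + n -> q < p + n -> (res p == res q) = (p == q).
Proof.
move=> pq qp; rewrite resE; wlog le_pq : p q pq qp / p <= q => [hw|].
  by case/orP: (leq_total p q) => /hw; [|rewrite eq_sym [RHS]eq_sym]; apply.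
rewrite eq_sym eqn_mod_dvd // [RHS]eq_sym; apply/idP/eqP => [/dvdn_leq|->].
  by lia.
by rewrite subnn dvdn0.
Qed.

Lemma resD p : res (p + n) = res p.
Proof. by apply/eqP; rewrite resE modnDr. Qed.

Lemma resS p : res p.+1 = (res p + 1)%R.
Proof. by rewrite /res GRing.mulrSr. Qed.

Lemma res_surj i : exists2 p, p < n & i = res p.
Proof.
exists (nat_of_ord i); last by rewrite /res natr_Zp.
by apply: leq_trans (ltn_ord i) _; rewrite Zp_cast //; lia.
Qed.

Lemma stepD p i : step (p + n) i = step p i + n.
Proof. by rewrite /step resD; case: ifP. Qed.

Lemma step_ge p i : p <= step p i.
Proof. by rewrite /step; case: ifP. Qed.

Lemma step_homo i p q : p <= q -> step p i <= step q i.
Proof.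
rewrite leq_eqVlt => /orP[/eqP->//|lt_pq]; apply: leq_trans (step_ge q i).
by rewrite /step; case: ifP => // _; apply: ltnW.
Qed.

Lemma walk_cons i w p : walk (i :: w) p = walk w (step p i).
Proof. by []. Qed.

Lemma walk_cat u v p : walk (u ++ v) p = walk v (walk u p).
Proof. exact: foldl_cat. Qed.

Lemma walkD w p : walk w (p + n) = walk w p + n.
Proof. by elim: w p => // i w IH p; rewrite !walk_cons stepD IH. Qed.

Lemma walk_ge w p : p <= walk w p.
Proof. by elim: w p => // i w IH p; apply: leq_trans (step_ge p i) (IH _). Qed.

Lemma walk_homo w p q : p <= q -> walk w p <= walk w q.
Proof. by elim: w p q => // i w IH p q /(step_homo i)/IH. Qed.

Lemma walk_notin w p : res p \notin w -> walk w p = p.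
Proof.
elim: w => // i w IH; rewrite inE negb_or => /andP[pi /IH].
by rewrite walk_cons /step (negPf pi).
Qed.

(** Each relation is checked at the positions where one of its letters acts.
    The braid relations need n >= 3: a walker that x_i x_{i+1} has carried
    from p to p + 2 must not be moved by a further x_i. *)
Lemma hk_cong_walk u v : hk_cong u v -> walk u =1 walk v.
Proof.
elim=> {u v} [u v uv|u|u v _ IH|v u w _ IH1 _ IH2|u u' v v' _ IH1 _ IH2] p.
- have S1 q i : (res q.+1 == i + 1)%R = (res q == i).
    by rewrite resS (inj_eq (GRing.addIr _)).
  have neqS q : (res q.+1 == res q) = false by rewrite res_near; lia.
  have neqSS q : (res q.+2 == res q) = false by rewrite res_near; lia.
  have neqS' q : (res q == res q.+1) = false by rewrite res_near; lia.
  case: uv => [i|i j ij ji1 ij1|i|i]; rewrite /walk /= /step.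
  + by case: (eqVneq (res p) i) => [<-|pi]; rewrite ?neqS ?(negPf pi).
  + case: (eqVneq (res p) i) => [pi|pi].
      rewrite -pi (negPf (_ : res p != j)) -?pi ?resS ?eqxx ?pi //.
      by rewrite [(_ + 1)%R == j]eq_sym (negPf ji1).
    case: (eqVneq (res p) j) => [pj|pj]; last by rewrite (negPf pi).
    by rewrite resS pj [(_ + 1)%R == i]eq_sym (negPf ij1).
  + case: (eqVneq (res p) i) => [<-|pi]; first by rewrite -resS eqxx neqSS.
    case: (eqVneq (res p) (i + 1)%R) => [pi1|pi1]; last by rewrite (negPf pi).
    case: eqP => // H; have: res p.+2 = res p by rewrite resS H -pi1.
    by move/eqP; rewrite neqSS.
  + case: (eqVneq (res p) i) => [<-|pi].
      by rewrite -resS neqS' !eqxx.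
    case: (eqVneq (res p) (i + 1)%R) => [pi1|pi1]; last first.
      by rewrite (negPf pi) (negPf pi1).
    have neqi : (res p.+1 == i) = false by rewrite -S1 -pi1 neqSS.
    by rewrite neqi -pi1 neqS.
- by [].
- by rewrite IH.
- by rewrite IH1 IH2.
- by rewrite !walk_cat IH1 IH2.
Qed.


Lemma walkDn w p k : walk w (p + k * n) = walk w p + k * n.
Proof.
elim: k => [|k IH]; first by rewrite !addn0.
by rewrite mulSn addnCA addnC walkD IH addnC addnCA.
Qed.

Lemma walk_res u v p q :
  res p = res q -> walk u p = walk v p -> walk u q = walk v q.
Proof.
have main p' q' k : q' = p' + k * n -> walk u p' = walk v p' <-> walk u q' = walk v q'.
  by move=> ->; rewrite !walkDn; split=> [->//|/addIn].
move/eqP; rewrite resE; case/orP: (leq_total p q) => [pq|qp].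
  rewrite eq_sym eqn_mod_dvd // => /dvdnP[k Ek] /(main p q k) -> //; lia.
by rewrite eqn_mod_dvd // => /dvdnP[k Ek] /(main q p k) -> //; lia.
Qed.

Lemma hk_catl u v w : hk_cong v w -> hk_cong (u ++ v) (u ++ w).
Proof. by move=> vw; apply: hk_cat vw; apply: hk_refl. Qed.

Lemma hk_catr u v w : hk_cong u v -> hk_cong (u ++ w) (v ++ w).
Proof. by move=> uv; apply: hk_cat uv _; apply: hk_refl. Qed.

(** Move the last letter x_{p+1} to the left.  It commutes with all letters of u
    other than itself and x_{p+2}; in front of x_{p+2} the induction hypothesis
    supplies one more x_{p+1}, and the braid relation
    x_{p+1} x_{p+2} x_{p+1} = x_{p+1} x_{p+2} removes the last one. *)
Lemma hk_absorb p u :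
  res p \notin u -> hk_cong (res p.+1 :: u ++ [:: res p.+1]) (res p.+1 :: u).
Proof.
set i := res p.+1; elim/last_ind: u => [_|u y IH].
  exact/hk_base/hk_idem.
rewrite mem_rcons inE negb_or => /andP[py /IH{}IH].
rewrite -cats1 -catA -!cat_cons cat1s.
have [->|yi] := eqVneq y i.
  exact/hk_catl/hk_base/hk_idem.
have [->|yi1] := eqVneq y (i + 1)%R.
  apply: (@hk_trans _ ((i :: u ++ [:: i]) ++ [:: (i + 1)%R; i])).
    exact/hk_catr/hk_sym.
  apply: (@hk_trans _ ((i :: u ++ [:: i]) ++ [:: (i + 1)%R])).
    by rewrite -!cat_cons -!catA; apply/hk_catl/hk_base/hk_braid1.
  exact: hk_catr.
apply: (@hk_trans _ ((i :: u) ++ [:: i; y])).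
  apply/hk_catl/hk_base/hk_comm => //; first by rewrite /i resS (inj_eq (GRing.addIr _)).
rewrite -[[:: i; y]]/([:: i] ++ [:: y]) catA.
exact: hk_catr.
Qed.

Lemma walk_in1 p u : res p.+1 \notin u -> res p \in u -> walk u p = p.+1.
Proof.
elim: u => // j u IH; rewrite !inE negb_or walk_cons /step => /andP[p1j p1u].
by case: eqVneq => [_ _|_ /(IH p1u)//]; rewrite walk_notin.
Qed.

Lemma split_first i u : i \in u -> exists u1 u2, u = u1 ++ i :: u2 /\ i \notin u1.
Proof.
elim: u => // j u IH; rewrite inE; have [->|ij] := eqVneq i j.
  by exists [::], u.
move/IH => [u1 [u2 [-> iu1]]]; exists (j :: u1), u2; split=> //.
by rewrite inE negb_or ij.
Qed.

(** The value of v at p + 1 is the least one compatible with monotonicity and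
    with q <= walk v q, and at the points not congruent to p + 1 the maps of v
    and w agree; so the map of v depends only on the map of w. *)
Lemma hk_peel w p : walk w p < walk w p.+1 -> walk w p.+1 = walk w p.+2 ->
  exists v, [/\ hk_cong w (res p.+1 :: v), size v < size w &
                walk v p.+1 = maxn (walk w p) p.+1].
Proof.
have [m] := ubnP (size w); elim: m w p => // m IH [|j u] p.
  by rewrite /walk /= => _ _; lia.
rewrite ltnS => /= size_u.
have neqS q : (res q == res q.+1) = false by rewrite res_near; lia.
have neqS' q : (res q.+1 == res q) = false by rewrite res_near; lia.
have neqSS q : (res q == res q.+2) = false by rewrite res_near; lia.
have neqSS' q : (res q.+2 == res q) = false by rewrite res_near; lia.
have [->|ji] := eqVneq j (res p.+1).
  rewrite !walk_cons /step eqxx neqS neqS' => lt_f _.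
  have [max_u|] := eqVneq (walk u p.+1) (maxn (walk u p) p.+1).
    by exists u; split=> //; apply: hk_refl.
  have := walk_ge u p.+1; have := walk_homo u (leqnSn p) => le_u ge_u max_u.
  (* If u does not yet take the least value at p + 1, then x_{p+1} occurs in u
     before the first x_p: otherwise the walkers from p and p + 1 would meet. *)
  have : res p.+1 \in u by apply: contraT => /walk_notin eq_u; lia.
  move=> /split_first[u1 [u2 [Eu p1u1]]].
  have pu1 : res p \notin u1.
    apply/negP => /(walk_in1 p1u1) walk_p.
    move: max_u; rewrite Eu !walk_cat walk_p (walk_notin p1u1); move: le_u ge_u.
    by rewrite Eu !walk_cat walk_p (walk_notin p1u1); lia.
  have cong_w : hk_cong (res p.+1 :: u) (res p.+1 :: u1 ++ u2).
    rewrite Eu -cat1s catA -[_ :: u2]cat1s catA -cat_cons.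
    by apply: hk_catr; rewrite cat1s; apply: hk_absorb.
  have Ef q : walk (res p.+1 :: u1 ++ u2) q = walk (res p.+1 :: u) q.
    by rewrite (hk_cong_walk cong_w).
  have size_w : size (res p.+1 :: u1 ++ u2) = size u.
    by rewrite Eu /= !size_cat /= addnS.
  have [|||v [cong_v size_v max_v]] := IH (res p.+1 :: u1 ++ u2) p.
  - by rewrite size_w.
  - by rewrite !Ef !walk_cons /step eqxx neqS.
  - by rewrite !Ef !walk_cons /step eqxx neqS'.
  exists v; split; first exact: hk_trans cong_w cong_v.
    by rewrite size_w in size_v; lia.
  by rewrite max_v Ef walk_cons /step neqS.
have [->|jp] := eqVneq j (res p).
  by rewrite !walk_cons /step eqxx neqS' ltnn.
have [->|ji1] := eqVneq j (res p.+2).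
  (* Peel x_{p+1} and then x_{p+2} off u: the braid relation turns
     x_{p+2} x_{p+1} x_{p+2} into x_{p+1} x_{p+2}. *)
  rewrite !walk_cons /step eqxx neqSS neqS => lt_f eq_f.
  have le_u1 := walk_homo u (leqnSn p.+1); have le_u2 := walk_homo u (leqnSn p.+2).
  have [|||v [cong_v size_v max_v]] := IH u p; try lia.
  have Ev q : res p.+1 != res q -> walk v q = walk u q.
    move=> pq; rewrite (hk_cong_walk cong_v) walk_cons /step.
    by rewrite eq_sym (negPf pq).
  have Ev3 : walk v p.+3 = walk u p.+3.
    by apply: Ev; rewrite neqSS.
  have Ev2 : walk v p.+2 = walk u p.+2.
    by apply: Ev; rewrite neqS.
  have := walk_ge u p.+2 => ge_u.
  have [|||v' [cong_v' size_v' max_v']] := IH v p.+1; try lia.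
  exists (res p.+2 :: v'); split; last 1 first.
  - by rewrite -(hk_cong_walk cong_v').
  - apply: (@hk_trans _ [:: res p.+2, res p.+1, res p.+2 & v']).
      apply: (@hk_trans _ [:: res p.+2, res p.+1 & v]).
        by rewrite -cat1s -[X in hk_cong _ X]cat1s; apply: hk_catl.
      rewrite -[X in hk_cong X _]/([:: res p.+2; res p.+1] ++ v).
      by rewrite -[X in hk_cong _ X]/([:: res p.+2; res p.+1] ++ _); apply: hk_catl.
    rewrite -[X in hk_cong X _]/([:: res p.+2; res p.+1; res p.+2] ++ v').
    rewrite -[X in hk_cong _ X]/([:: res p.+1; res p.+2] ++ v').
    by apply: hk_catr; rewrite (resS p.+1); apply/hk_base/hk_braid2.
  - by rewrite /=; lia.
rewrite !walk_cons /step ![res _ == j]eq_sym (negPf ji) (negPf jp) (negPf ji1).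
move=> lt_f eq_f; have [|||v [cong_v size_v max_v]] := IH u p; try done.
exists (j :: v); split=> //; last first.
  by rewrite walk_cons /step eq_sym (negPf ji).
apply: (@hk_trans _ [:: j, res p.+1 & v]).
  by rewrite -cat1s -[X in hk_cong _ X]cat1s; apply: hk_catl.
rewrite -[X in hk_cong X _]/([:: j; res p.+1] ++ v).
rewrite -[X in hk_cong _ X]/([:: res p.+1; j] ++ v).
apply/hk_catr/hk_base/hk_comm => //; last by rewrite -resS.
by rewrite resS (inj_eq (GRing.addIr _)) eq_sym.
Qed.

(** If w starts with x_q, its map is flat from q to q + 1.  As it commutes with the
    translation by n, it is not flat everywhere below: take the last jump. *)
Lemma walk_descent w : w != [::] ->
  exists p, walk w p < walk w p.+1 /\ walk w p.+1 = walk w p.+2.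
Proof.
case: w => // j u _; have [q _ ->] := res_surj j.
set f := walk _; set q' := q + n.
have f_q' : f q' = f q'.+1.
  have Eq : res q = res q' by rewrite resD.
  by rewrite /f !walk_cons /step Eq eqxx [_ == res q']res_near ?ifF //; lia.
have ex_p : exists p, f p < f q' by exists q; rewrite /f /q' walkD; lia.
have le_p p : f p < f q' -> p <= q'.
  by apply: contraTT; rewrite -ltnNge -leqNgt => /ltnW/walk_homo; apply.
case: (ex_maxnP ex_p le_p) => p lt_p max_p; exists p.
have lt_pq : p < q'.
  by rewrite ltn_neqAle le_p // andbT; apply: contraTneq lt_p => ->; rewrite ltnn.
have f_p1 : f p.+1 = f q'.
  apply/eqP; rewrite eqn_leq walk_homo //= leqNgt; apply/negP => /max_p.
  by rewrite ltnn.
split; first by rewrite f_p1.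
apply/eqP; rewrite eqn_leq walk_homo //= f_p1 f_q'.
exact: walk_homo.
Qed.

(** Both words can be peeled at the same place, and the two rests again have the
    same map. *)
Lemma walk_inj u v : walk u =1 walk v -> hk_cong u v.
Proof.
have [m] := ubnP (size u); elim: m u v => // m IH u v.
have [->|u_neq0] := eqVneq u [::] => size_u uv.
  have [->|/walk_descent[p [_]]] := eqVneq v [::]; first exact: hk_refl.
  by rewrite -!uv /walk /=; lia.
have [p [lt_p eq_p]] := walk_descent u_neq0.
have [u' [cong_u size_u' max_u]] := hk_peel lt_p eq_p.
have [|//|v' [cong_v size_v' max_v]] := @hk_peel v p; rewrite -?uv //.
apply: (hk_trans cong_u (hk_trans _ (hk_sym cong_v))).
rewrite -cat1s -[X in hk_cong _ X]cat1s; apply/hk_catl/IH; first by lia.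
move=> q; have [pq|pq] := eqVneq (res p.+1) (res q).
  by apply: walk_res pq _; rewrite max_u max_v uv.
have Eq w : walk w q = walk (res p.+1 :: w) q.
  by rewrite walk_cons /step eq_sym (negPf pq).
by rewrite (Eq u') (Eq v') -(hk_cong_walk cong_u) -(hk_cong_walk cong_v).
Qed.

End Walk.

Local Open Scope quotient_scope.

(** * The action of the elements of the monoid, and the involution *)

Definition act (n : nat) (c : Cn n) : nat -> nat := walk (repr c).

Lemma add_ind d (P : nat -> Prop) : 0 < d ->
  (forall t, t < d -> P t) -> (forall p, P p -> P (p + d)) -> forall p, P p.
Proof.
move=> d_gt0 P0 PD; elim/ltn_ind => p IH; have [/P0//|le_dp] := ltnP p d.
by rewrite -(subnK le_dp); apply/PD/IH; lia.
Qed.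

Section Act.
Variable n : nat.
Hypothesis n_ge3 : 3 <= n.
Implicit Types (p q k : nat) (c d : Cn n) (w : seq nat).

Local Notation res := (res n).

Lemma act_pi u : act (\pi_(Cn n) u) =1 walk u.
Proof. exact/hk_cong_walk/Cn_reprP. Qed.

Lemma act_mul c d p : act (c * d)%g p = act d (act c p).
Proof.
elim/Cn_ind: c => u; elim/Cn_ind: d => v.
by rewrite [(_ * _)%g]Cn_mul_pi !act_pi walk_cat.
Qed.

Lemma act1 p : act (1%g : Cn n) p = p.
Proof. exact: act_pi. Qed.

Lemma actD c p : act c (p + n) = act c p + n.
Proof. exact: walkD. Qed.

Lemma act_n c : act c n = act c 0 + n.
Proof. exact: (actD c 0). Qed.

Lemma actDn c p k : act c (p + k * n) = act c p + k * n.
Proof. exact: walkDn. Qed.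

Lemma act_ge c p : p <= act c p.
Proof. exact: walk_ge. Qed.

Lemma act_homo c p q : p <= q -> act c p <= act c q.
Proof. exact: walk_homo. Qed.

Lemma act_inj c d : act c =1 act d -> c = d.
Proof.
elim/Cn_ind: c => u; elim/Cn_ind: d => v cd; apply/Cn_eqP/walk_inj => // p.
by rewrite -!act_pi.
Qed.

Lemma act_inj_window a c d :
  (forall p, a <= p < a + n -> act c p = act d p) -> c = d.
Proof.
move=> cd; apply: act_inj => p.
have main q : a <= q -> act c q = act d q.
  move=> aq; rewrite -(subnK aq); elim/(@add_ind n): (q - a); first by lia.
    by move=> t t_lt; apply: cd; lia.
  by move=> t IH; rewrite addnAC !actD IH.
by apply: (@addIn (a * n)); rewrite -!actDn; apply: main; nia.
Qed.

Lemma act_elt w p : act (elt n w) p = walk [seq res k | k <- w] p.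
Proof. exact: act_pi. Qed.

Lemma act_elt_cat w w' p :
  act (elt n (w ++ w')) p = act (elt n w') (act (elt n w) p).
Proof. by rewrite elt_cat act_mul. Qed.

Lemma act_elt0 p : act (elt n [::]) p = p.
Proof. exact: act_elt. Qed.

Lemma act_letter k p : k < p + n -> p < k + n ->
  act (elt n [:: k]) p = if p == k then p.+1 else p.
Proof. by move=> *; rewrite act_elt /walk /= /step res_near. Qed.

Lemma elt_addn k : elt n [:: k + n] = elt n [:: k].
Proof. by rewrite /elt /= -[(_%:R)%R]/(res _) resD. Qed.

Lemma upS a b : a <= b -> up a b = a :: up a.+1 b.
Proof. by move=> ab; rewrite /up subSn. Qed.

Lemma up0 a b : b < a -> up a b = [::].
Proof. by rewrite /up -subn_eq0 => /eqP->. Qed.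

Lemma downS a b : a <= b -> down b a = rcons (down b a.+1) a.
Proof. by move=> ab; rewrite /down upS // rev_cons. Qed.

Lemma down0 a b : b < a -> down b a = [::].
Proof. by move=> ba; rewrite /down up0. Qed.

Lemma act_up a b p : b < p + n -> p < a + n ->
  act (elt n (up a b)) p = if a <= p <= b then b.+1 else p.
Proof.
have [m] := ubnP (b.+1 - a); elim: m a p => // m IH a p size_ab b_lt p_lt.
have [le_ab|lt_ba] := leqP a b; last by rewrite up0 // act_elt0 ifF //; lia.
rewrite upS // -cat1s act_elt_cat act_letter; try lia.
by case: eqP => pa; (rewrite IH; [|lia|lia|lia]); case: ifP => ?; case: ifP => ?; lia.
Qed.

Lemma act_down a b p : b < p + n -> p < a + n -> b.+1 < a + n ->
  act (elt n (down b a)) p = if a <= p <= b then p.+1 else p.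
Proof.
have [m] := ubnP (b.+1 - a); elim: m a p => // m IH a p size_ab b_lt p_lt ab.
have [le_ab|lt_ba] := leqP a b; last by rewrite down0 // act_elt0 ifF //; lia.
rewrite downS // -cats1 act_elt_cat IH; try lia.
by case: ifP => ?; rewrite act_letter; try lia; do 2 case: ifP; lia.
Qed.

(** The map chi_i on words: x_k is replaced by x_{i+1-k}, and the order of the
    letters is reversed. *)
Definition flip i (u : seq 'Z_n) : seq 'Z_n := rev [seq (res i.+1 - x)%R | x <- u].

Lemma chi_pi i u : chi i (\pi_(Cn n) u) = \pi_(Cn n) (flip i u).
Proof.
have iter_pi m v : iter m (@sigma n) (\pi_(Cn n) v) =
    \pi_(Cn n) [seq (x + res m)%R | x <- v].
  elim: m => [|m IH].
    by rewrite /= (@eq_map _ _ _ id) ?map_id // => x; rewrite GRing.addr0.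
  rewrite iterS IH sigma_pi -map_comp; congr (\pi_(Cn n) _).
  by apply: eq_map => x /=; rewrite resS GRing.addrA.
rewrite /chi tau_pi iter_pi /flip map_rev -map_comp; congr (\pi_(Cn n) (rev _)).
by apply: eq_map => x /=; rewrite GRing.addrC.
Qed.

Lemma chiM i c d : chi i (c * d)%g = (chi i d * chi i c)%g.
Proof.
elim/Cn_ind: c => u; elim/Cn_ind: d => v.
by rewrite [(_ * _)%g]Cn_mul_pi !chi_pi [RHS]Cn_mul_pi /flip map_cat rev_cat.
Qed.

Lemma chi1 i : chi i (1%g : Cn n) = 1%g.
Proof. exact: chi_pi. Qed.

Lemma chiX i c k : chi i (c ^+ k)%g = (chi i c ^+ k)%g.
Proof. by elim: k => [|k IH]; rewrite ?expg0 ?chi1 // expgS chiM IH expgSr. Qed.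

Lemma chiK i : involutive (@chi n i).
Proof.
elim/Cn_ind => u; rewrite !chi_pi /flip map_rev revK -map_comp.
rewrite (@eq_map _ _ _ id) ?map_id // => x /=.
by rewrite GRing.opprB GRing.addrC GRing.subrK.
Qed.

Lemma chi_elt i w : all (geq n) w ->
  chi i (elt n w) = elt n (rev [seq n + i.+1 - k | k <- w]).
Proof.
move=> /allP w_le; rewrite /elt chi_pi /flip map_rev -!map_comp.
congr (\pi_(Cn n) (rev _)); apply/eq_in_map => k /w_le /= k_le.
rewrite GRing.natrB; last by lia.
by rewrite [RHS]/(res (n + i.+1) - _)%R addnC resD.
Qed.

Lemma step_adj N p q j : q < N ->
  (@step n p j <= q) = (@step n (N - q) (res N - j)%R <= N - p).
Proof.
move=> qN; have [pq|qp] := leqP p q; last first.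
  by have := step_ge p j; have := step_ge (N - q) (res N - j)%R; lia.
rewrite /step; have -> : (res (N - q) == res N - j)%R = (res q == j).
  rewrite {1}/res GRing.natrB 1?ltnW // -[(N%:R)%R]/(res N).
  by rewrite (inj_eq (GRing.addrI _)) (inj_eq GRing.oppr_inj).
have [<-|pq'] := eqVneq p q; first by case: ifP; lia.
by do 2 case: ifP; lia.
Qed.

(** On maps, chi_i is the passage to the right adjoint
    q |-> max {p | act c p <= q}, conjugated with the reflection
    p |-> i + 1 - p.  Modulo n this is the reflection at L n + i + 1, for any L;
    the multiple of n keeps all points inside the natural numbers. *)
Lemma act_adj i L c p q : q < L * n + i.+1 ->
  (act c p <= q) =
  (act (chi i c) (L * n + i.+1 - q) <= L * n + i.+1 - p).
Proof.
elim/Cn_ind: c => u; rewrite chi_pi !act_pi; set N := L * n + _ => qN.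
have resN : res i.+1 = res N.
  rewrite /N; elim: L {N qN} => [//|L ->]; rewrite -(resD n_ge3 (L * n + _)).
  by congr (res _); rewrite mulSn; lia.
rewrite /flip resN; elim: u p => [|j u IH] p; first by rewrite /walk /=; lia.
rewrite walk_cons IH /= rev_cons -cats1 walk_cat; set z := walk _ (N - q).
have z_ge : N - q <= z := walk_ge _ _.
rewrite [walk [:: _] _]/walk /=.
have [zN|Nz] := leqP z N.
  have := @step_adj N p (N - z) j; rewrite subKn // => <-; last by lia.
  by have := step_ge p j; lia.
have := step_ge z (res N - j)%R; rewrite /walk /=; lia.
Qed.

End Act.

(** * The generator as a shift *)

(** The rank of x_n q_i and of its positive powers, see [rank_xqXS]. *)
Definition rk (n i : nat) : nat := n.-1 - i.

(** The sites enumerate the points from i + 2 on that are not congruent to one of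
    1, ..., i + 1, and [lev p] is the index of the first site after p.  So
    [lev n i] jumps exactly at the points i + 1, ..., n - 1 modulo n. *)
Definition lev (n i p : nat) : nat := p %/ n * rk n i + (p %% n - i.+1).

Definition site (n i m : nat) : nat := i.+2 + m %/ rk n i * n + m %% rk n i.

Section Level.
Variables n i : nat.
Hypothesis n_ge3 : 3 <= n.
Hypothesis i_le : i <= n - 2.
Implicit Types (p q k m : nat) (c d : Cn n).

Local Notation r := (rk n i).
Local Notation lev := (lev n i).
Local Notation site := (site n i).
Local Notation x := (xq n i).

Lemma rkE : (r + i).+1 = n.
Proof. by rewrite /rk; lia. Qed.

Lemma rk_gt0 : 0 < r.
Proof. by rewrite /rk; lia. Qed.

Lemma levD p : lev (p + n) = lev p + r.
Proof.
have n_gt0 : 0 < n by lia.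
by rewrite /lev modnDr divnDr // divnn n_gt0 mulnDl mul1n addnAC.
Qed.

Lemma levDn p k : lev (p + k * n) = lev p + k * r.
Proof.
elim: k => [|k IH]; first by rewrite !addn0.
have -> : p + k.+1 * n = p + k * n + n by lia.
by rewrite levD IH; lia.
Qed.

Lemma lev_small p : p <= n -> lev p = p - i.+1.
Proof.
rewrite leq_eqVlt => /orP[/eqP->|p_lt]; last by rewrite /lev divn_small ?modn_small.
have -> : lev n = lev 0 + r by rewrite -levD.
by rewrite /lev div0n mod0n; have rE := rkE; lia.
Qed.

Lemma siteD m : site (m + r) = site m + n.
Proof.
by rewrite /site modnDr divnDr // divnn rk_gt0 mulnDl mul1n; lia.
Qed.

Lemma siteDn m k : site (m + k * r) = site m + k * n.
Proof.
elim: k => [|k IH]; first by rewrite !addn0.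
have -> : m + k.+1 * r = m + k * r + r by lia.
by rewrite siteD IH; lia.
Qed.

Lemma site_small m : m < r -> site m = i.+2 + m.
Proof. by move=> m_lt; rewrite /site divn_small // modn_small // addn0. Qed.

Lemma site_ltS m : site m < site m.+1.
Proof.
elim/(@add_ind r): m => [|t t_lt|m IH]; first exact: rk_gt0; last by rewrite -addSn !siteD; lia.
rewrite site_small //; have rE := rkE; have [t1_lt|] := ltnP t.+1 r.
  by rewrite site_small //; lia.
move=> le_rt; have -> : t.+1 = 0 + r by lia.
by rewrite siteD site_small ?rk_gt0 //; lia.
Qed.

Lemma site_lt m m' : (site m < site m') = (m < m').
Proof.
have homo := homo_ltn ltn_trans site_ltS.
apply/idP/idP => [|/homo//]; apply: contraTT; rewrite -!leqNgt leq_eqVlt.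
by case/orP => [/eqP->//|/homo/ltnW].
Qed.

Lemma site_le m m' : (site m <= site m') = (m <= m').
Proof. by rewrite leqNgt site_lt -leqNgt. Qed.

Lemma site_inj : injective site.
Proof. by move=> m m' /eqP; rewrite eqn_leq !site_le -eqn_leq => /eqP. Qed.

Lemma lev_leS p : lev p <= lev p.+1 <= (lev p).+1.
Proof.
have n_gt0 : 0 < n by lia.
elim/(@add_ind n): p => [//|t t_lt|m IH]; last by rewrite -addSn !levD; lia.
by rewrite !lev_small; lia.
Qed.

Lemma lev_homo p q : p <= q -> lev p <= lev q.
Proof.
by apply: (homo_leq leqnn leq_trans) => k; have /andP[] := lev_leS k.
Qed.

Lemma lev_site m : lev (site m) = m.+1.
Proof.
elim/(@add_ind r): m => [|t t_lt|m IH]; first exact: rk_gt0; last by rewrite siteD levD IH; lia.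
by rewrite site_small // lev_small; have rE := rkE; lia.
Qed.

Lemma site_lev_gt p : p < site (lev p).
Proof.
have n_gt0 : 0 < n by lia.
elim/(@add_ind n): p => [//|t t_lt|m IH]; last by rewrite levD siteD; lia.
rewrite (lev_small (ltnW t_lt)); have rE := rkE.
by rewrite site_small; lia.
Qed.

Lemma act_xq p : act x p = site (lev p).
Proof.
have n_gt0 : 0 < n by lia.
elim/(@add_ind n): p => [//|t t_lt|m IH]; last by rewrite actD // IH levD siteD.
rewrite /xq /qword -cat1s !act_elt_cat // (elt_addn n_ge3 0 : elt n [:: n] = _).
rewrite (lev_small (ltnW t_lt)) site_small; last by have rE := rkE; lia.
rewrite act_letter; try lia.
case: eqP => t0; rewrite act_up; try lia; case: ifP => ?; rewrite act_down; try lia.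
all: by case: ifP => ?; lia.
Qed.

Lemma act_xqX k p : act (x ^+ k.+1)%g p = site (lev p + k).
Proof.
elim: k => [|k IH]; first by rewrite expg1 act_xq addn0.
by rewrite expgSr act_mul // IH act_xq lev_site addnS.
Qed.

Lemma rev_map_up N a b : a <= N -> b <= N ->
  rev [seq N - k | k <- up a b] = up (N - b) (N - a).
Proof.
rewrite /up => aN bN; apply: (@eq_from_nth _ 0).
  by rewrite size_rev size_map !size_iota; lia.
rewrite size_rev size_map size_iota => j j_lt.
by rewrite nth_rev ?(nth_map 0) ?size_map ?size_iota ?nth_iota; lia.
Qed.

Lemma rev_map_down N a b : a <= N -> b <= N ->
  rev [seq N - k | k <- down b a] = down (N - a) (N - b).
Proof. by move=> aN bN; rewrite /down map_rev revK -rev_map_up // revK. Qed.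

(** Up to the translation of indices by n, chi_i turns x_n q_i into the word
    x_n x_{n-1} ... x_{i+2} x_1 ... x_i x_{i+1}, which acts by the same map. *)
Lemma chi_xq : chi i x = x.
Proof.
rewrite {1}/xq chi_elt //; last first.
  apply/allP => k; rewrite /qword inE mem_cat mem_rev !mem_iota.
  by case/or3P => [/eqP->|/andP[] ? ?|/andP[] ? ?]; rewrite /=; lia.
rewrite -cat1s /qword !map_cat !rev_cat rev_map_up ?rev_map_down; try lia.
have -> : n + i.+1 - i.+1 = n by lia.
have -> : n + i.+1 - n.-1 = i.+2 by lia.
have -> : n + i.+1 - i = n.+1 by lia.
have -> : n + i.+1 - 1 = n + i by lia.
rewrite (_ : rev _ = [:: i.+1]); last by rewrite /rev /= addKn.
apply: (@act_inj_window _ _ i.+2) => // p /andP[p_ge p_lt].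
rewrite !act_elt_cat // -(elt_addn n_ge3 i.+1) act_xq.
have [p_ltn|p_gen] := ltnP p n.
  rewrite (lev_small (ltnW p_ltn)) site_small; last by have rE := rkE; lia.
  by rewrite act_down; [|lia..]; case: ifP => H1; (rewrite act_up; [|lia..]);
    case: ifP => H2; (rewrite act_letter; [|lia..]); case: eqP => ?; lia.
have -> : site (lev p) = n + i.+2.
  rewrite -(subnK p_gen) levD siteD lev_small ?site_small; have rE := rkE; lia.
by rewrite act_down; [|lia..]; case: ifP => H1; (rewrite act_up; [|lia..]);
  case: ifP => H2; (rewrite act_letter; [|lia..]); case: eqP => ?; lia.
Qed.

Lemma chi_xqX k : chi i (x ^+ k)%g = (x ^+ k)%g.
Proof. by rewrite chiX chi_xq. Qed.

End Level.

(** * The maps of the elements of A_i and B_i *)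

(** What characterises the elements of A_i ([AsetE]).  Followed by x_n q_i, only
    the levels of their values matter; they climb by at most one at each step, so
    that every level is reached, and no point is moved farther than its level
    requires. *)
Definition gathers n i (c : Cn n) : Prop :=
  [/\ act c 0 = 0,
      forall p, p <= n -> act c p <= i.+1 -> act c p = p &
      forall p, lev n i (act c p.+1) <= (lev n i (act c p)).+1].

(** What characterises the elements of B_i ([BsetE]).  They act on the sites
    i + 2, ..., n, which they place without collision in the window from i + 2 to
    n + i + 1; the points 1, ..., i + 1 only give way to the image of n,
    translated by - n. *)
Definition spreads n i (c : Cn n) : Prop :=
  [/\ act c n <= n + i.+1,
      forall p, i.+1 < p < n -> act c p < act c p.+1 &
      forall p, 1 <= p <= i.+1 -> act c p = maxn p (act c n - n)].

Section Shapes.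
Variables n i : nat.
Hypothesis n_ge3 : 3 <= n.
Hypothesis i_le : i <= n - 2.
Implicit Types (p q k m : nat) (c d : Cn n).

Local Notation r := (rk n i).
Local Notation lev := (lev n i).
Local Notation site := (site n i).

Lemma gathers_n c : act c 0 = 0 -> act c n = n.
Proof. by move=> c0; rewrite act_n // c0. Qed.

(** Two sites with the same image under chi_i c would be a step at which c climbs
    by two levels. *)
Lemma gathers_chi c : gathers i c -> spreads i (chi i c).
Proof.
case=> c0 c_id c_step; have cn := gathers_n c0; set d := chi i c.
have adj L p q : q < L * n + i.+1 ->
    (act d p <= q) = (act c (L * n + i.+1 - q) <= L * n + i.+1 - p).
  by move=> q_lt; rewrite (@act_adj n n_ge3 i L d p q) // chiK.
have dn : act d n <= n + i.+1.
  rewrite (adj 2); last by lia.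
  have -> : 2 * n + i.+1 - (n + i.+1) = n by lia.
  by lia.
split=> // [p /andP[p_gt p_lt]|p /andP[p_gt0 p_le]].
  rewrite ltnNge; apply/negP => le_d.
  set y := act d p in le_d; have y_ge : p <= y := act_ge d p.
  have := adj y.+1 p.+1 y; rewrite le_d => /(_ ltac:(nia))/esym.
  have /= := adj y.+1 p y.-1; rewrite -/y => /(_ ltac:(nia)).
  set N := y.+1 * n + i.+1.
  have -> : N - y.-1 = (N - y).+1 by rewrite /N; nia.
  set z := N - y; have -> : (y <= y.-1) = false by lia.
  move=> /esym/negbT; rewrite -ltnNge => lt_z le_z.
  have := c_step z; rewrite leqNgt => /negP[].
  have lev_v t : i.+1 <= t <= n -> lev (y * n + t) = y * r + (t - i.+1).
    by move=> t_lt; rewrite addnC levDn // lev_small; lia.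
  have N_p : N - p = y * n + (n + i.+1 - p) by rewrite /N; nia.
  have := @lev_homo _ _ n_ge3 i_le _ _ le_z.
  have := @lev_homo _ _ n_ge3 i_le _ _ lt_z.
  have -> : N - p.+1 = y * n + (n + i - p) by rewrite /N; nia.
  have -> : (N - p).+1 = y * n + (n + i.+2 - p) by rewrite N_p; lia.
  by rewrite !lev_v; lia.
have [d0_le p_le_d] : act d 0 <= i.+1 /\ act d 0 <= act d p.
  by split; [have := act_n n_ge3 d; lia|apply: act_homo].
have -> : act d n - n = act d 0 by rewrite act_n // addnK.
apply/eqP; rewrite eqn_leq geq_max act_ge p_le_d !andbT.
set q := maxn _ _; rewrite (adj 1); last by lia.
have := adj 1 0 q; rewrite leq_maxr => /(_ ltac:(lia))/esym.
have -> : 1 * n + i.+1 - q = (i.+1 - q) + n by lia.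
rewrite actD // => c_le; have c_q : act c (i.+1 - q) = i.+1 - q by apply: c_id; lia.
by lia.
Qed.

(** A step at which chi_i c climbs by two levels skips a site v; the reflection of
    v and its successor then have the same image under c. *)
Lemma spreads_chi c : spreads i c -> gathers i (chi i c).
Proof.
case=> cn c_inc c_max; set d := chi i c.
have adj L p q : q < L * n + i.+1 ->
    (act d p <= q) = (act c (L * n + i.+1 - q) <= L * n + i.+1 - p).
  by move=> q_lt; rewrite (@act_adj n n_ge3 i L d p q) // chiK.
have ci : act c i.+1 = i.+1 by rewrite c_max; lia.
split=> [|p p_le d_le|p].
- by apply/eqP; rewrite -leqn0 (adj 0) //= mul0n !subn0 add0n ci.
- apply/eqP; rewrite eqn_leq act_ge andbT.
  have := act_ge d p => d_ge; have [p_eq|p_neq] := eqVneq p i.+1; first by lia.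
  have p_lt : p < i.+1 by lia.
  rewrite (adj 1); last by lia.
  move: d_le; rewrite (adj 1); last by lia.
  have -> : 1 * n + i.+1 - i.+1 = n by lia.
  have -> : 1 * n + i.+1 - p = i.+1 - p + n by lia.
  rewrite actD // => cn_le; have [->|p_gt0] := posnP p; first by rewrite subn0 ci.
  by rewrite c_max; lia.
rewrite leqNgt; apply/negP => lt_lev.
set m := lev (act d p) in lt_lev; set v := site m.
have lt_v : act d p < v := site_lev_gt n_ge3 i_le _.
have v_lt : v < act d p.+1.
  rewrite ltnNge; apply/negP => /(lev_homo n_ge3 i_le).
  by rewrite lev_site //; lia.
have Em := divn_eq m r; set k := m %/ r in Em; set t := m %% r in Em.
have t_lt : t < r by rewrite ltn_mod rk_gt0.
have rE := rkE n_ge3 i_le.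
have Ev : v = i.+2 + t + k * n by rewrite /v Em addnC siteDn // site_small.
set N := k.+1 * n + i.+1.
have NvE : N - v = (n - 1 - t) + 0 * n by rewrite /N Ev; lia.
have v_lt' : (act d p.+1 <= v) = false by lia.
have := adj k.+1 p.+1 v; rewrite v_lt' -/N => /(_ ltac:(lia))/esym/negbT.
have := adj k.+1 p v.-1; rewrite -/N => /(_ ltac:(lia)).
have -> : act d p <= v.-1 by lia.
have -> : N - v.-1 = (N - v).+1 by lia.
move=> /esym le_c; rewrite -ltnNge => lt_c.
have : act c (N - v) < act c (N - v).+1.
  rewrite NvE mul0n addn0; have [->|ti] := eqVneq (n - 1 - t) i.+1; last by apply: c_inc; lia.
  by rewrite ci; apply: leq_trans (act_ge _ _).
have p_le : p <= N by have := act_ge d p; lia.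
lia.
Qed.

Lemma gathers_inj c d : gathers i c -> gathers i d ->
  (forall p, p <= n -> lev (act c p) = lev (act d p)) -> c = d.
Proof.
move=> gc gd cd; apply: (@act_inj_window _ n_ge3 1) => p p_in.
have main (e : Cn n) : gathers i e ->
    act e p = if lev (act e p) == 0 then p else i.+1 + lev (act e p).
  case=> e0 e_id _; have e_le : act e p <= n.
    by rewrite -[X in _ <= X](gathers_n e0); apply: act_homo; lia.
  by rewrite (lev_small n_ge3 i_le) //; case: eqP => [E0|]; [apply: e_id|]; lia.
by rewrite (main c gc) (main d gd) cd //; lia.
Qed.

Lemma spreads_inj c d : spreads i c -> spreads i d ->
  (forall m, m < r -> act c (site m) = act d (site m)) -> c = d.
Proof.
case=> _ _ c_max [_ _ d_max] cd; have rE := rkE n_ge3 i_le.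
have big p : i.+1 < p <= n -> act c p = act d p.
  move=> p_in; have := cd (p - i.+2); rewrite !site_small; try lia.
  by rewrite subnKC; [apply|]; lia.
apply: (@act_inj_window _ n_ge3 1) => p p_in.
have [p_le|p_gt] := leqP p i.+1; last by apply: big; lia.
by rewrite (c_max p) 1?(d_max p) 1?(big n); lia.
Qed.

Lemma spreads_site_ltS c m : spreads i c -> act c (site m) < act c (site m.+1).
Proof.
case=> cn c_inc c_max; have rE := rkE n_ge3 i_le; have r_gt0 := rk_gt0 n_ge3 i_le.
have actsD k : act c (site (k + r)) = act c (site k) + n by rewrite siteD // actD.
elim/(@add_ind r): m => // [t t_lt|m IH]; last by rewrite -addSn !actsD; lia.
rewrite site_small //; have [t1_lt|le_r] := ltnP t.+1 r.
  by rewrite site_small // addnS; apply: c_inc; lia.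
have -> : t.+1 = 0 + r by lia.
rewrite actsD site_small //; have -> : i.+2 + t = n by lia.
by have := act_ge c (i.+2 + 0); lia.
Qed.

End Shapes.

(** * The words of A_i *)

(** The descending part of the words of A_i, from the block that ends in x_{s+1}
    on. *)
Definition down_blocks i s (k : nat -> nat) : seq nat :=
  flatten [seq down (k q) q | q <- iota s.+1 (i.+1 - s)].

Lemma down_blocksS i s (k : nat -> nat) : s <= i ->
  down_blocks i s k = down (k s.+1) s.+1 ++ down_blocks i s.+1 k.
Proof. by move=> s_le; rewrite /down_blocks subSn. Qed.

Lemma down_blocks_nil i k : down_blocks i i.+1 k = [::].
Proof. by rewrite /down_blocks subnn. Qed.

Lemma eq_down_blocks i s k k' : (forall q, s < q -> k q = k' q) ->
  down_blocks i s k = down_blocks i s k'.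
Proof.
move=> kk'; rewrite /down_blocks; congr flatten; apply/eq_in_map => q.
by rewrite mem_iota => /andP[/kk'->].
Qed.

Lemma drop_up m a b : drop m (up a b) = up (a + m) b.
Proof. by rewrite /up drop_iota; congr iota; lia. Qed.

Lemma drop_down m a b : 0 < a -> drop m (down b a) = down (b - m) a.
Proof.
move=> a_gt0; rewrite /down drop_rev /up size_iota take_iota.
by congr (rev (iota _ _)); lia.
Qed.

Section AWords.
Variables n i : nat.
Hypothesis n_ge3 : 3 <= n.
Hypothesis i_le : i <= n - 2.
Implicit Types (p q m s : nat) (k : nat -> nat) (w : seq nat).

Local Notation r := (rk n i).
Local Notation lev := (lev n i).
Local Notation down_blocks := (down_blocks i).

(** The block x_k ... x_{s+1} moves s + 1, ..., k up by one, so prepending it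
    shifts this part of the map one place to the left and repeats the value at
    k + 1.  Steps of at most one are preserved. *)
Lemma act_down_blocks k s : s <= i.+1 ->
  (forall q, s < q <= i.+1 -> q <= k q < n) ->
  let f := act (elt n (down_blocks s k)) in
  [/\ forall p, p <= s -> f p = p, f s.+1 = i.+2, f n = n &
      forall p, s < p < n -> f p.+1 <= (f p).+1].
Proof.
have [d] := ubnP (i.+1 - s); elim: d s => // d IH s size_s.
rewrite leq_eqVlt ltnS => /orP[/eqP-> _|s_le k_in f].
  by rewrite down_blocks_nil /=; split=> [p||| p]; rewrite !act_elt0.
 have [||q|f_id f_s f_n f_step] := IH s.+1; try lia.
  by move=> q_in; apply: k_in; lia.
have k_s : s.+1 <= k s.+1 < n by apply: k_in; lia.
have fE p : p <= n -> f p =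
    act (elt n (down_blocks s.+1 k)) (if s.+1 <= p <= k s.+1 then p.+1 else p).
  by move=> p_le; rewrite /f down_blocksS // act_elt_cat // act_down //; lia.
split=> [p p_le|||p p_in].
- by rewrite fE 1?ifF ?f_id; lia.
- by rewrite fE 1?ifT ?f_s; lia.
- by rewrite fE 1?ifF ?f_n; lia.
rewrite !fE; try lia; case: ifP => H1; case: ifP => H2; try lia.
- by apply: f_step; lia.
- by apply: f_step; lia.
Qed.

(** With m = s the ascending block is empty: this covers the suffixes that start at
    a descending block. *)
Lemma gathers_word k s m : s <= i.+1 -> m <= s ->
  (forall q, s < q <= i.+1 -> q <= k q < n) ->
  gathers i (elt n (up m.+1 s ++ down_blocks s k)).
Proof.
move=> s_le m_le k_in; have [] := act_down_blocks s_le k_in.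
set f := act _ => f_id f_s f_n f_step; set c := elt n _.
have cE p : p <= n -> act c p = f (if m < p <= s then s.+1 else p).
  by move=> p_le; rewrite /c act_elt_cat // act_up //; lia.
have f_homo : forall p q, p <= q -> f p <= f q by move=> p q; apply: act_homo.
have c0 : act c 0 = 0 by rewrite cE // f_id.
split=> // [p p_le|p].
  rewrite cE //; case: ifP => p_in; first by rewrite f_s; lia.
  have [p_le_s _|p_gt] := leqP p s; first by rewrite f_id.
  by have := f_homo s.+1 p p_gt; rewrite f_s; lia.
have n_gt0 : 0 < n by lia.
elim/(@add_ind n): p => // [p p_lt|p IH]; last first.
  by rewrite -addSn !actD // !(levD n_ge3 i_le); lia.
have f_le t : t <= n -> f t <= n by rewrite -{2}f_n; apply: f_homo.
rewrite !cE ?(lev_small n_ge3 i_le); try by [lia|apply: f_le; lia]; last first.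
- by case: ifP => ?; apply: f_le; lia.
- by case: ifP => ?; apply: f_le; lia.
have [p_le|p_gt] := leqP p s; last by rewrite !ifF; have := f_step p; lia.
have [->|p_neq] := eqVneq p s; first by rewrite ifF ?f_s //; lia.
have [p_le_m|p_gt_m] := leqP p.+1 m; first by rewrite ifF ?f_id; lia.
by rewrite ifT ?f_s; lia.
Qed.

(** A suffix that starts inside a descending block has the same shape again.  A
    block of which only the last letter x_q is left counts as an ascending one. *)
Lemma drop_down_blocks k s m : s <= i.+1 ->
  (forall q, s < q <= i.+1 -> q < k q < n) ->
  exists s' m' k', [/\ s' <= i.+1, m' <= s',
    forall q, s' < q <= i.+1 -> q <= k' q < n &
    drop m (down_blocks s k) = up m'.+1 s' ++ down_blocks s' k'].
Proof.
have [d] := ubnP (i.+1 - s); elim: d s m => // d IH s m size_s.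
rewrite leq_eqVlt ltnS => /orP[/eqP-> _|s_le k_in].
  exists i.+1, i.+1, k; rewrite down_blocks_nil up0 //=; split=> // q; lia.
rewrite down_blocksS // drop_cat; case: ifP => m_lt; last first.
  by apply: IH => [||q q_in]; [lia..|apply: k_in; lia].
rewrite drop_down //; have k_s : s.+1 < k s.+1 < n by apply: k_in; lia.
have [k_le|k_gt] := leqP (k s.+1 - m) s.+1.
  exists s.+1, (s.+1 - (k s.+1 - m == s.+1)), k; split=> // [|q q_in|].
  - by lia.
  - by have := k_in q; lia.
  congr (_ ++ _); case: eqP => [->|k_neq]; last by rewrite subn0 down0 ?up0 //; lia.
  by rewrite subn1 /down /up subSnn.
pose k1 q := if q == s.+1 then k s.+1 - m else k q.
exists s, s, k1; split=> [||q q_in|]; try lia.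
  by rewrite /k1; case: eqP => [->|_]; [|have := k_in q]; lia.
rewrite up0 // (@down_blocksS i s k1) // {1}/k1 eqxx; congr (_ ++ _).
by apply: eq_down_blocks => q q_gt; rewrite /k1 ifF //; lia.
Qed.

(** The k's increase, so that k_{i+1} <= n - 1 bounds them all. *)
Lemma Aset_gathers c : Aset n i c -> gathers i c.
Proof.
case=> s [k [w [[s_le k_s k_gt k_lt k_n] sw ->]]].
have k_in q : s < q <= i.+1 -> q < k q < n.
  case/andP=> q_gt q_le; rewrite k_gt //=.
  have : k q <= k i.+1.
    elim/(@ltn_ind): {q_gt q_le}(i.+1 - q) {-2}q (erefl (i.+1 - q)) q_gt q_le
      => d IH t Et t_gt t_le.
    have [->//|t_neq] := eqVneq t i.+1.
    by apply: leq_trans (ltnW (k_lt t t_gt _)) (IH (i.+1 - t.+1) _ t.+1 _ _ _); lia.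
  by have := k_n; lia.
have {sw} : exists m, w = drop m (A_word i s k).
  by case/suffixP: sw => w' ->; exists (size w'); rewrite drop_size_cat.
case=> m; rewrite /A_word -/(down_blocks s k).
have drop_case m' : w = drop m' (down_blocks s k) -> gathers i (elt n w).
  have [s' [m0 [k' [? ? ? ->]]]] := drop_down_blocks m' s_le k_in.
  by move=> ->; apply: gathers_word.
have k_in' q : s < q <= i.+1 -> q <= k q < n by move/k_in; lia.
case: ifP => [s_gt0|_]; last exact: drop_case.
rewrite drop_cat; case: ifP => [m_lt|_]; last exact: drop_case.
rewrite drop_up => ->; have ks := k_s s_gt0.
move: m_lt; rewrite /up size_iota => m_lt.
have -> : k s + m = (k s + m).-1.+1 by lia.
by apply: gathers_word => //; lia.
Qed.

(** The first flat step t of N gives the first block, x_t ... x_{s+1}.  Without it,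
    the map must be N moved one place to the right on s + 2, ..., t + 1; this
    destroys the flat step t and keeps the later ones, which give the other
    blocks.  So the k's are the flat steps of N, in increasing order. *)
Lemma down_blocks_ex s (N : nat -> nat) : s <= i.+1 ->
  N s.+1 = 1 -> (s <= i -> N s.+2 = 2) -> N n = r ->
  (forall p, s < p < n -> N p <= N p.+1 <= (N p).+1) ->
  exists k, [/\ forall q, s < q <= i.+1 -> q < k q < n,
    forall q, s < q -> q < i.+1 -> k q < k q.+1,
    s <= i -> N (k s.+1).+1 = N (k s.+1) &
    forall p, s < p <= n -> act (elt n (down_blocks s k)) p = i.+1 + N p].
Proof.
have rE := rkE n_ge3 i_le.
have [d] := ubnP (i.+1 - s); elim: d s N => // d IH s N size_s s_le N1 N2 Nn N_step.
have N_slope t p : s < t -> t <= p <= n -> N p <= N t + (p - t).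
  move=> t_gt; elim: p => [|p IHp] t_le; first by lia.
  have [->|t_neq] := eqVneq t p.+1; first by lia.
  by have := N_step p; lia.
move: s_le; rewrite leq_eqVlt ltnS => /orP[/eqP Es|s_le].
  exists id; split=> [q q_in|q q_gt q_lt|s_i|p p_in]; [lia..|].
  rewrite Es down_blocks_nil act_elt0 //.
  by have := N_slope s.+1 p; have := N_slope p n; lia.
have flat : exists t, (s < t < n) && (N t.+1 == N t).
  have [//|no_flat] := pselect (exists t, (s < t < n) && (N t.+1 == N t)).
  have N_lin p : s < p <= n -> N p = p - s.
    elim: p => [|p IHp] p_in; first by lia.
    have [->|p_neq] := eqVneq p s; first by lia.
    have := IHp; have := N_step p; have [E|] := eqVneq (N p.+1) (N p); last by lia.
    by case: no_flat; exists p; rewrite E eqxx; lia.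
  by have := N_lin n; lia.
case: (ex_minnP flat) => t /andP[t_in /eqP Nt] t_min.
have t_gt : s.+1 < t.
  rewrite ltn_neqAle; apply/andP; split; last by lia.
  by apply/eqP => E; move: Nt; rewrite -E N2 // N1.
pose N' p := if p <= t.+1 then N p.-1 else N p.
have [||||||k [k_in k_lt k_flat kE]] := IH s.+1 N'; rewrite ?/N'; try lia.
- by case: ifP => H1 //=; lia.
- by move=> s_lt; case: ifP => H1 /=; [apply: N2|]; lia.
- case: ifP => // n_le; have -> : n.-1 = t by lia.
  by rewrite -Nt -Nn; congr N; lia.
- move=> p p_in; have [p_gt|p_le] := ltnP t p.
    have -> : (if p <= t.+1 then N p.-1 else N p) = N p.
      by case: ifP => // H; have -> : p = t.+1 by [lia]; rewrite /= Nt.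
    by rewrite ifF; [apply: N_step|]; lia.
  by rewrite !ifT /=; try lia; have := N_step p.-1; rewrite prednK; lia.
pose k1 q := if q == s.+1 then t else k q.
have blocksE : down_blocks s k1 = down t s.+1 ++ down_blocks s.+1 k.
  rewrite (@down_blocksS i s k1) // {1}/k1 eqxx; congr (_ ++ _).
  by apply: eq_down_blocks => q q_gt; rewrite /k1 ifF //; lia.
exists k1; split=> [q q_in|q q_gt q_lt|_|p p_in].
- by rewrite /k1; case: eqP => [->|?]; [|have := k_in q]; lia.
- rewrite /k1; case: eqP => [Eq|q_neq]; last by rewrite ifF; [apply: k_lt|]; lia.
  rewrite ifF; last by lia.
  rewrite Eq ltnNge; apply/negP => k_le.
  have k_s : s.+2 < k s.+2 < n by apply: k_in; lia.
  have := k_flat; rewrite /N' !ifT; try lia; move=> /(_ ltac:(lia)) /= E.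
  have := t_min (k s.+2).-1; rewrite prednK; last by lia.
  by rewrite E eqxx; lia.
- by rewrite /k1 eqxx.
rewrite blocksE act_elt_cat // act_down //; try lia; case: ifP => H1.
  by rewrite kE /N' ?ifT //; lia.
rewrite kE /N'; last by lia.
case: ifP => // H2; have -> : p = t.+1 by lia.
by rewrite /= Nt.
Qed.

(** Let m and s + 1 be the last points where N is 0 and 1.  The ascending block
    x_{m+1} ... x_s lifts the points in between to s + 1, and the descending
    blocks take care of the points after s + 1. *)
Lemma Aset_ex (N : nat -> nat) : N 0 = 0 -> N n = r ->
  (forall p, p < n -> N p <= N p.+1 <= (N p).+1) ->
  exists2 c, Aset n i c & forall p, p <= n -> lev (act c p) = N p.
Proof.
move=> N0 Nn N_step; have rE := rkE n_ge3 i_le; have r_gt0 := rk_gt0 n_ge3 i_le.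
have N_homo p q : p <= q -> q <= n -> N p <= N q <= N p + (q - p).
  elim: q => [|q IHq] p_le q_le; first by have -> : p = 0; lia.
  have [->|p_neq] := eqVneq p q.+1; first by lia.
  by have := N_step q; lia.
have max_ex v : v <= r -> exists t, [/\ t <= n, N t = v & forall p, p <= n -> N p <= v -> p <= t].
  move=> v_le; have ex0 : exists t, (t <= n) && (N t <= v) by exists 0; rewrite N0.
  have bound t : (t <= n) && (N t <= v) -> t <= n by case/andP.
  case: (ex_maxnP ex0 bound) => t /andP[t_le Nt] t_max; exists t; split=> //.
    have [Et|t_neq] := eqVneq t n; first by move: Nt; rewrite Et Nn; lia.
    have := t_max t.+1; have := N_step t; lia.
  by move=> p p_le Np; apply: t_max; rewrite p_le.
have [m [m_le Nm m_max]] := max_ex 0 isT.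
have [[|s] [s_le Ns s_max]] := max_ex 1 r_gt0; first by lia.
have m_lt : m <= s by have := N_homo s.+1 m; lia.
have s_lei : s <= i.+1 by have := N_homo s.+1 n; lia.
have [|//||//||k [k_in k_lt k_flat kE]] := @down_blocks_ex s N; try lia.
- by move=> s_i; have := N_step s.+1; have := s_max s.+2; lia.
- by move=> p p_in; apply: N_step; lia.
exists (elt n (up m.+1 s ++ down_blocks s k)).
  pose k1 q := if q == s then minn m.+1 s else k q.
  have k1E q : s < q -> k1 q = k q by move=> q_gt; rewrite /k1 ifF //; lia.
  exists s, k1, (up m.+1 s ++ down_blocks s k); split=> //.
    split=> // [s_gt0|q q_gt q_le|q q_gt q_lt|s_lt].
    - by rewrite /k1 eqxx; lia.
    - by rewrite k1E //; have := k_in q; lia.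
    - by rewrite !k1E //; [apply: k_lt|lia].
    by rewrite k1E //; have := k_in i.+1; lia.
  rewrite /A_word -/(down_blocks s k1) (eq_down_blocks _ k1E) /k1 eqxx.
  have [Em|m_neq] := eqVneq m s.
    by rewrite Em up0 //; apply: suffix_suffix.
  rewrite ifT; last by lia.
  have -> : minn m.+1 s = m.+1 by lia.
  exact: suffix_refl.
have k_in' q : s < q <= i.+1 -> q <= k q < n by move/k_in; lia.
have [f_id f_s f_n _] := act_down_blocks s_lei k_in'.
move=> p p_le; rewrite act_elt_cat // act_up //; try lia; case: ifP => H1.
  rewrite f_s (lev_small n_ge3 i_le) ?subSnn; last by lia.
  by have := N_homo p s.+1; have := m_max p; lia.
have [p_le_s|p_gt] := leqP p s.
  rewrite f_id // (lev_small n_ge3 i_le) //.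
  by have := N_homo p m; lia.
rewrite kE; last by lia.
by have N_le := N_homo p n p_le (leqnn n); rewrite (lev_small n_ge3 i_le); lia.
Qed.

Lemma AsetE c : Aset n i c <-> gathers i c.
Proof.
split; [exact: Aset_gathers|move=> gc].
have [c0 c_id c_step] := gc; have cn := gathers_n n_ge3 c0.
have rE := rkE n_ge3 i_le.
have [|||d Ad cd] := @Aset_ex (fun p => lev (act c p)).
- by rewrite c0 (lev_small n_ge3 i_le).
- by rewrite cn (lev_small n_ge3 i_le) //; lia.
- by move=> p _; rewrite c_step andbT; apply: lev_homo => //; apply: act_homo.
suff -> : c = d by [].
apply: (gathers_inj n_ge3 i_le gc (Aset_gathers Ad)) => p p_le.
by rewrite cd.
Qed.

End AWords.

(** * The words of B_i *)

Definition block n (p : nat * nat) : seq nat := n :: up 1 p.1 ++ down n.-1 p.2.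

Definition block_word n (L : seq (nat * nat)) : seq nat := flatten [seq block n p | p <- L].

(** The pairs (i_l, j_l) of the blocks.  Here i_l = 0 and j_l = n are allowed, by
    strictness only in the last pair, so that a last block that is cut short is a
    block as well, and the prefixes in the definition of B_i are exactly the block
    words of staircases. *)
Definition staircase n i (L : seq (nat * nat)) : Prop :=
  [/\ pairwise gtn (i.+1 :: map fst L), pairwise ltn (i.+1 :: map snd L) &
      all (geq n) (map snd L)].

Lemma gtn_trans : transitive gtn.
Proof. by move=> y x z /= yx zy; apply: ltn_trans zy yx. Qed.

Lemma block_word_rcons n L p :
  block_word n (rcons L p) = block_word n L ++ block n p.
Proof. by rewrite /block_word map_rcons flatten_rcons. Qed.

Lemma staircase_rcons n i L a b : staircase n i (rcons L (a, b)) <->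
  [/\ staircase n i L, a <= i, i.+1 < b <= n,
      forall z, z \in map fst L -> a < z & forall z, z \in map snd L -> z < b].
Proof.
rewrite /staircase !map_rcons -!rcons_cons !pairwise_rcons all_rcons /=.
split=> [[/andP[/andP[ai /allP aL] ->] /andP[/andP[ib /allP bL] ->] /andP[bn ->]]|].
  by split=> //; rewrite ib.
case=> -[-> -> ->] ai /andP[ib bn] aL bL.
by rewrite /= ltnS ai ib bn !andbT; split=> //=; apply/allP.
Qed.

Section BWords.
Variables n i : nat.
Hypothesis n_ge3 : 3 <= n.
Hypothesis i_le : i <= n - 2.
Implicit Types (p q m v : nat) (w : seq nat) (L : seq (nat * nat)).

Local Notation r := (rk n i).
Local Notation site := (site n i).
Local Notation staircase := (staircase n i).
Local Notation block := (block n).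
Local Notation block_word := (block_word n).

Lemma act_block a b v : a <= i -> i.+1 < b <= n -> 1 <= v <= n + i.+1 ->
  act (elt n (block (a, b))) v =
  if v <= a then a.+1 else
  if b <= v < n then v.+1 else
  if n <= v <= n + a then n + a.+1 else v.
Proof.
move=> a_le b_in v_in; rewrite /block /= -cat1s !act_elt_cat //.
have low u : 1 <= u < n ->
    act (elt n (down n.-1 b)) (act (elt n (up 1 a)) u) =
    if u <= a then a.+1 else if b <= u < n then u.+1 else u.
  move=> u_in; rewrite act_up //; try lia.
  by case: ifP => H; rewrite act_down //; try lia; repeat case: ifP => ?; lia.
have [v_lt|v_ge] := ltnP v n.
  rewrite act_letter //; try lia; rewrite ifF ?low; try lia.
  by repeat case: ifP => ?; lia.
have -> : act (elt n [:: n]) v = (if v == n then 1 else v - n) + n.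
  have [->|v_neq] := eqVneq v n.
    by rewrite act_letter ?eqxx //; lia.
  by rewrite act_letter //; try lia; rewrite (negPf v_neq); lia.
rewrite !actD // low; last by case: eqP; lia.
by case: eqP => v_eq; repeat case: ifP => ?; lia.
Qed.

(** A block with the pair (a, b) moves n to n + a + 1, beyond n but before all the
    points that were moved there earlier, and fills the gap by moving
    b, ..., n - 1 up by one.  So b leaves the image of the sites i + 2, ..., n and
    n + a + 1 enters it. *)
Lemma act_block_word L : staircase L ->
  spreads i (elt n (block_word L)) /\
  forall v, i.+1 < v <= n + i.+1 ->
    (exists2 p, i.+1 < p <= n & act (elt n (block_word L)) p = v) <->
    (if v <= n then v \notin map snd L else v - n.+1 \in map fst L).
Proof.
elim/last_ind: L => [_|L [a b] IH].
  rewrite /block_word /=; split.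
    by split=> [|p p_in|p p_in]; rewrite !act_elt0 //; lia.
  move=> v v_in; split=> [[p p_in]|]; rewrite ?act_elt0 //.
    by move=> <-; rewrite ifT //; lia.
  by case: ifP => // v_le _; exists v; rewrite ?act_elt0 //; lia.
case/staircase_rcons => /IH[[f_n f_inc f_max] f_im] a_le b_in aL bL.
rewrite block_word_rcons; set f := act (elt n (block_word L)) in f_n f_inc f_max f_im *.
set c := elt n _.
have f_homo p q : p <= q -> f p <= f q by apply: act_homo.
have f_ge p : p <= f p by apply: act_ge.
have f_in p : i.+1 < p <= n -> i.+1 < f p <= n + i.+1.
  by move=> p_in; have := f_ge p; have := f_homo p n; lia.
have f_hi p : i.+1 < p <= n -> n < f p -> n + a.+1 < f p.
  move=> p_in fp_gt; have [fp _] := f_im (f p) (f_in p p_in).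
  have : f p - n.+1 \in map fst L by rewrite leqNgt fp_gt in fp; apply: fp; exists p.
  by move/aL; lia.
have cE p : i.+1 < p <= n -> act c p =
    if f p < b then f p else if f p < n then (f p).+1 else
    if f p == n then n + a.+1 else f p.
  move=> p_in; rewrite /c act_elt_cat // -/f act_block //; have := f_in p p_in; try lia.
  have := f_hi p p_in; repeat case: ifP => ?; lia.
have f_n_in : i.+1 < n <= n by lia.
split.
  split=> [|p p_in|p p_in].
  - by rewrite cE //; repeat case: ifP => ?; lia.
  - rewrite !cE; try lia; have := f_inc p p_in.
    have := f_hi p.+1; have := f_hi p; repeat case: ifP => ?; lia.
  rewrite /c act_elt_cat // -/f act_block //; have fp := f_max p p_in; try lia.
  have := f_ge n; have := f_hi n f_n_in; rewrite -/c cE // => ? ?.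
  by repeat case: ifP => ?; lia.
move=> v v_in; rewrite !map_rcons !mem_rcons !inE /=.
have im_lt u : i.+1 < u <= n -> u \notin map snd L -> exists2 p, i.+1 < p <= n & f p = u.
  by move=> u_in uL; apply/f_im; [|rewrite ifT]; lia.
have notin_b u : b <= u -> u \notin map snd L by move=> ?; apply/negP => /bL; lia.
split=> [[p p_in]|].
  rewrite cE //; have := f_in p p_in; have := f_hi p p_in => hi fp_in.
  have im_f : if f p <= n then f p \notin map snd L else f p - n.+1 \in map fst L.
    by apply/(f_im _ fp_in); exists p.
  case: ifP => [fp_lt <-|fp_ge].
    by move: im_f; rewrite !ifT; try lia; rewrite negb_or => ->; rewrite andbT; lia.
  case: ifP => [fp_lt <-|fp_ge2].
    by rewrite ifT ?negb_or ?notin_b; lia.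
  case: eqP => [fp_n <-|fp_neq <-].
    by rewrite ifF; [apply/orP; left|]; lia.
  rewrite ifF; last by lia.
  by move: im_f; rewrite ifF => [->|]; [rewrite orbT|lia].
case: ifP => v_le.
  rewrite negb_or => /andP[v_neq vL]; have [v_lt|v_gt] := ltnP v b.
    have [|p p_in fp] := im_lt v _ vL; first by lia.
    by exists p => //; rewrite cE // fp v_lt.
  have [||p p_in fp] := im_lt v.-1; try by [lia|apply: notin_b; lia].
  by exists p => //; rewrite cE // fp; repeat case: ifP => ?; lia.
case/orP => [/eqP v_a|vL].
  have [||p p_in fp] := im_lt n; try by [lia|apply: notin_b; lia].
  by exists p => //; rewrite cE // fp; repeat case: ifP => ?; lia.
have [p p_in fp] : exists2 p, i.+1 < p <= n & f p = v.
  by apply/f_im => //; rewrite v_le.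
exists p => //; rewrite cE // fp; have := f_hi p p_in; repeat case: ifP => ?; lia.
Qed.


Lemma staircase_zip si sj : size si = size sj ->
  path gtn i.+1 si -> path ltn i.+1 sj -> all (geq n) sj -> staircase (zip si sj).
Proof.
move=> size_eq si_path sj_path sj_le.
have fstE : map fst (zip si sj) = si by apply: unzip1_zip; rewrite size_eq.
have sndE : map snd (zip si sj) = sj by apply: unzip2_zip; rewrite size_eq.
split; rewrite ?fstE ?sndE // -path_pairwise //.
  exact: gtn_trans.
exact: ltn_trans.
Qed.

Lemma path_ltn_rcons x s z : path ltn x (rcons s z) -> forall y, y \in s -> y < z.
Proof.
rewrite path_pairwise; last exact: ltn_trans.
by rewrite -rcons_cons pairwise_rcons /= => /andP[/andP[_ /allP]].
Qed.

Lemma B_word_blocks w : B_word n i w -> exists2 L, staircase L & w = block_word L.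
Proof.
case=> [si sj j size_eq si_ge si_path sj_path j_le|si sj a size_eq a_ge si_path sj_path sj_le].
  exists (zip (rcons si 0) (rcons sj j)).
    apply: staircase_zip => //; rewrite ?size_rcons ?size_eq //.
      rewrite rcons_path si_path /=; case/lastP: si si_ge {size_eq si_path} => // si x.
      by rewrite all_rcons last_rcons => /andP[].
    rewrite all_rcons /= j_le; apply/allP => z /(path_ltn_rcons sj_path) z_lt /=.
    by lia.
  by rewrite zip_rcons // block_word_rcons.
exists (zip (rcons si a) (rcons sj n)).
  apply: staircase_zip => //; rewrite ?size_rcons ?size_eq //.
    rewrite rcons_path sj_path /=; case/lastP: sj sj_le {size_eq sj_path} => [_|sj x] /=.
      by lia.
    by rewrite all_rcons last_rcons => /andP[/= ? _]; lia.
  rewrite all_rcons /= leqnn; apply/allP => z /(allP sj_le) /=; lia.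
rewrite zip_rcons // block_word_rcons /block /= down0 ?cats0 //; lia.
Qed.

(** A block that is cut short is the block of (a', n) with a' <= a, or of (a, b')
    with b' >= b. *)
Lemma take_block_word L m : staircase L ->
  exists2 L', staircase L' & take m (block_word L) = block_word L'.
Proof.
elim/last_ind: L => [_|L [a b] IH]; first by exists [::].
case/staircase_rcons => sL a_le b_in aL bL.
rewrite block_word_rcons take_cat; case: ifP => _; first exact: IH.
set m' := m - _; rewrite /block; case: m' => [|m'] /=; first by exists L; rewrite ?cats0.
have cut a' b' : a' <= a -> b <= b' <= n -> staircase (rcons L (a', b')).
  move=> a'_le b'_in; apply/staircase_rcons; split=> // [||z /aL|z /bL]; lia.
rewrite take_cat; case: ltnP => [m'_lt|m'_ge].
  have m'_le : m' <= a by move: m'_lt; rewrite size_iota; lia.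
  exists (rcons L (m', n)); first by apply: cut; lia.
  rewrite block_word_rcons /block /= down0 ?cats0; last by lia.
  by rewrite take_iota; congr (_ ++ _ :: iota _ _); lia.
set m2 := m' - _; exists (rcons L (a, maxn b (n - m2))); first by apply: cut; lia.
rewrite block_word_rcons /block /=; congr (_ ++ _ :: _ ++ _).
rewrite /down take_rev /up size_iota drop_iota; congr (rev (iota _ _)); lia.
Qed.

Lemma Bset_block_word c : Bset n i c ->
  exists2 L, staircase L & c = elt n (block_word L).
Proof.
case=> v [w [/B_word_blocks[L sL ->] + ->]]; rewrite prefixE => /eqP <-.
by have [L' sL' ->] := take_block_word (size w) sL; exists L'.
Qed.

Lemma Bset_spreads c : Bset n i c -> spreads i c.
Proof. by case/Bset_block_word => L sL ->; have [] := act_block_word sL. Qed.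

(** The kinds (a) and (b) of words differ in the last pair, which has i_l = 0
    or j_l = n; any other staircase is obtained from kind (a) by removing a final
    x_n. *)
Lemma block_word_Bset L : staircase L -> Bset n i (elt n (block_word L)).
Proof.
case/lastP: L => [_|L [a b]].
  exists [:: n], [::]; split=> //.
  have := @B_word_a n i [::] [::] n; rewrite /B_blocks /= down0; last by lia.
  by apply=> //=; lia.
move=> sLab; have [sL a_le b_in aL bL] := (iffLR (staircase_rcons _ _ _ _ _)) sLab.
have [si_p sj_p sj_le] := sL.
have si_path : path gtn i.+1 (map fst L) by rewrite path_pairwise //; apply: gtn_trans.
have sj_path : path ltn i.+1 (map snd L) by rewrite path_pairwise //; apply: ltn_trans.
have [si_p' sj_p' sj_le'] := sLab.
have si_path' : path gtn i.+1 (map fst (rcons L (a, b))).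
  by rewrite path_pairwise //; apply: gtn_trans.
have sj_path' : path ltn i.+1 (map snd (rcons L (a, b))).
  by rewrite path_pairwise //; apply: ltn_trans.
have blocksE L' : block_word L' = B_blocks n (map fst L') (map snd L').
  by rewrite /B_blocks zip_unzip.
have size_eq L' : size (map fst L') = size (map snd L') by rewrite !size_map.
have [a0|a_gt0] := posnP a.
  exists (block_word (rcons L (a, b))), (block_word (rcons L (a, b))).
  split=> //; last exact: prefix_refl.
  have b_le : b <= n by case/andP: b_in.
  rewrite a0 block_word_rcons blocksE; apply: B_word_a => //.
    by apply/allP => z /aL; apply: leq_ltn_trans.
  by move: sj_path'; rewrite map_rcons.
have [bn|b_neq] := eqVneq b n.
  exists (block_word (rcons L (a, b))), (block_word (rcons L (a, b))).
  split=> //; last exact: prefix_refl.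
  have blockE : block (a, n) = n :: up 1 a.
    by rewrite /block /= down0 ?cats0 //; clear -n_ge3; lia.
  rewrite bn block_word_rcons blocksE blockE.
  apply: B_word_b => //; first by move: si_path'; rewrite map_rcons.
  by apply/allP => z /bL /=; rewrite bn; clear -n_ge3; lia.
exists (block_word (rcons L (a, b)) ++ n :: down n.-1 n), (block_word (rcons L (a, b))).
split=> //; last exact: prefix_prefix.
rewrite blocksE; apply: B_word_a => //.
  apply/allP => z; rewrite map_rcons mem_rcons inE => /orP[/eqP->//|/aL].
  exact: leq_ltn_trans.
rewrite rcons_path sj_path' map_rcons last_rcons /= ltn_neqAle b_neq.
by case/andP: b_in.
Qed.

Lemma sorted_homo_iota (f : nat -> nat) a m :
  (forall p q, a <= p -> p < q -> q < a + m -> f p < f q) ->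
  sorted ltn (map f (iota a m)).
Proof.
move=> f_inc; apply: (@homo_sorted_in _ _ [pred p | a <= p < a + m] f ltn ltn).
- by move=> p q /andP[p_ge _] /andP[_ q_lt] /= pq; apply: f_inc.
- by apply/allP => p; rewrite mem_iota.
- exact: iota_ltn_sorted.
Qed.

(** By [act_block_word] the staircase is forced: its first components are the
    values of E beyond n, in decreasing order and diminished by n + 1, its second
    components the points among i + 2, ..., n that E misses.  There are as many of
    the former as of the latter, because E takes r values and r = n - 1 - i.  The
    image of the resulting element is the image of E, and an increasing
    enumeration is determined by its image. *)
Lemma Bset_ex (E : nat -> nat) : i.+1 < E 0 -> E r.-1 <= n + i.+1 ->
  (forall m, E m < E m.+1) ->
  exists2 c, Bset n i c & forall m, m < r -> act c (site m) = E m.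
Proof.
move=> E_ge E_le E_inc; have rE := rkE n_ge3 i_le; have r_gt0 := rk_gt0 n_ge3 i_le.
have E_lt : {homo E : p q / p < q} by apply: homo_ltn => //; apply: ltn_trans.
have E_in m : m < r -> i.+1 < E m <= n + i.+1.
  have E_homo p q : p <= q -> E p <= E q.
    by rewrite leq_eqVlt => /orP[/eqP->//|/E_lt/ltnW].
  by move=> m_lt; have := E_homo 0 m; have := E_homo m r.-1; lia.
pose es := map E (iota 0 r).
have es_sorted : sorted ltn es.
  by apply: sorted_homo_iota => p q _ pq _; apply: E_lt.
have es_uniq : uniq es := sorted_uniq ltn_trans ltnn es_sorted.
have es_in v : v \in es -> i.+1 < v <= n + i.+1.
  by case/mapP => m; rewrite mem_iota => /andP[_ m_lt] ->; apply: E_in.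
pose hs := [seq g <- rev (iota 0 i.+1) | n.+1 + g \in es].
pose js := [seq j <- iota i.+2 r | j \notin es].
have size_hs : size hs = size js.
  have hs_perm : perm_eq (map (addn n.+1) hs) [seq v <- es | n < v].
    apply: uniq_perm;
      rewrite ?filter_uniq ?(map_inj_uniq (@addnI _)) ?filter_uniq ?rev_uniq ?iota_uniq //.
    move=> v; rewrite mem_filter; apply/mapP/andP => [[g]|[v_gt v_es]].
      by rewrite mem_filter => /andP[g_es _] ->; split=> //; lia.
    exists (v - n.+1); last by lia.
    rewrite mem_filter mem_rev mem_iota; have -> : n.+1 + (v - n.+1) = v by lia.
    by rewrite v_es; have := es_in v v_es; lia.
  have js_perm : perm_eq [seq j <- iota i.+2 r | j \in es] [seq v <- es | ~~ (n < v)].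
    apply: uniq_perm; rewrite ?filter_uniq ?iota_uniq // => v.
    rewrite !mem_filter mem_iota -leqNgt; have := es_in v; case: (v \in es); lia.
  have hi_lo : size [seq v <- es | n < v] + size [seq v <- es | ~~ (n < v)] = r.
    by rewrite !size_filter [LHS]count_predC size_map size_iota.
  have in_out : size [seq j <- iota i.+2 r | j \in es] + size js = r.
    by rewrite !size_filter [LHS](count_predC (mem es)) size_iota.
  have E1 := perm_size js_perm; have E2 := perm_size hs_perm; rewrite size_map in E2.
  by apply: (@addnI (size [seq j <- iota i.+2 r | j \in es])); rewrite in_out E1 E2 addnC.
pose L := zip hs js.
have sL : staircase L.
  apply: staircase_zip => //.
  - rewrite path_pairwise ?pairwise_cons; last exact: gtn_trans.
    apply/andP; split.
      by apply/allP => g; rewrite mem_filter mem_rev mem_iota => /andP[_] /=; lia.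
    apply: pairwise_filter; rewrite -sorted_pairwise; last exact: gtn_trans.
    by rewrite rev_sorted; apply: iota_ltn_sorted.
  - rewrite path_pairwise ?pairwise_cons; last exact: ltn_trans.
    apply/andP; split; first by apply/allP => g; rewrite mem_filter mem_iota => /andP[_] /=; lia.
    apply: pairwise_filter; rewrite -sorted_pairwise; last exact: ltn_trans.
    exact: iota_ltn_sorted.
  - by apply/allP => g; rewrite mem_filter mem_iota => /andP[_] /=; lia.
have [sp im] := act_block_word sL; set c := elt n _ in sp im.
exists c; first exact: block_word_Bset.
have fstE : map fst L = hs by apply: unzip1_zip; rewrite size_hs.
have sndE : map snd L = js by apply: unzip2_zip; rewrite size_hs.
have [f_n f_inc _] := sp.
have f_lt p q : i.+1 < p -> p < q -> q <= n -> act c p < act c q.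
  move=> p_gt; elim: q => // q IHq pq q_lt.
  have [<-|p_neq] := eqVneq p q; first by apply: f_inc; lia.
  by apply: ltn_trans (IHq _ _) (f_inc q _); lia.
have fE : map (act c) (iota i.+2 r) = es.
  apply: (irr_sorted_eq ltn_trans ltnn) => //.
    by apply: sorted_homo_iota => p q *; apply: f_lt; lia.
  move=> v.
  have f_in p : i.+1 < p <= n -> i.+1 < act c p <= n + i.+1.
    by move=> p_in; have := act_ge c p; have := f_lt p n; have [->|] := eqVneq p n; lia.
  have es_im : i.+1 < v <= n + i.+1 ->
      (v \in es) = (if v <= n then v \notin map snd L else v - n.+1 \in map fst L).
    move=> v_in; rewrite fstE sndE !mem_filter mem_rev !mem_iota.
    case: ifP => v_le; last first.
      have -> : n.+1 + (v - n.+1) = v by lia.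
      by case: (v \in es) => //=; lia.
    have -> : i.+1 < v < i.+2 + r by lia.
    by rewrite andbT negbK.
  apply/mapP/idP => [[p]|v_es].
    rewrite mem_iota => p_in vE; have v_in : i.+1 < v <= n + i.+1 by rewrite vE; apply: f_in; lia.
    by rewrite es_im //; apply/(im v v_in); exists p => //; lia.
  have v_in := es_in v v_es; move: v_es; rewrite es_im // => /(im v v_in)[p p_in <-].
  by exists p => //; rewrite mem_iota; lia.
move=> m m_lt; rewrite site_small //.
have := congr1 (fun s => nth 0 s m) fE.
by rewrite !(nth_map 0) ?size_iota // !nth_iota.
Qed.

Lemma BsetE c : Bset n i c <-> spreads i c.
Proof.
split; [exact: Bset_spreads|move=> sc]; have rE := rkE n_ge3 i_le.
have r_gt0 := rk_gt0 n_ge3 i_le; have [c_n _ _] := sc.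
have [|||d Bd cd] := @Bset_ex (fun m => act c (site m)).
- by rewrite site_small //; apply: leq_trans (act_ge _ _); lia.
- rewrite site_small; last by lia.
  by have -> : i.+2 + r.-1 = n by lia.
- by move=> m; apply: spreads_site_ltS.
have -> // : c = d.
by apply: (spreads_inj n_ge3 i_le sc (Bset_spreads Bd)) => m /cd.
Qed.

End BWords.

(** * Rank, normal forms and divisors of the powers of the generator *)

Lemma homoS (f : nat -> nat) : (forall p, f p <= f p.+1) -> {homo f : p q / p <= q}.
Proof. by move=> fS; apply: (homo_leq leqnn leq_trans). Qed.

Lemma lt_jumps (f g : nat -> nat) :
  (forall p, f p <= f p.+1) -> (forall p, g p <= g p.+1) ->
  (forall p, g p < g p.+1 -> f p < f p.+1) ->
  forall p q, g p < g q -> f p < f q.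
Proof.
move=> /homoS f_homo /homoS g_homo gf p; elim=> [|q IH] lt_g.
  by have := g_homo 0 p (leq0n p); lia.
have [/IH lt_f|le_g] := ltnP (g p) (g q).
  exact: leq_trans lt_f (f_homo _ _ (leqnSn q)).
apply: leq_ltn_trans (gf q _); last exact: leq_ltn_trans le_g lt_g.
by apply: f_homo; rewrite leqNgt; apply/negP => /g_homo; lia.
Qed.

Lemma periodicDn (f : nat -> nat) d e : (forall p, f (p + d) = f p + e) ->
  forall p k, f (p + k * d) = f p + k * e.
Proof.
move=> fD p; elim=> [|k IH]; first by rewrite !addn0.
have -> : p + k.+1 * d = p + k * d + d by lia.
by rewrite fD IH; lia.
Qed.

(** A discrete intermediate value theorem on one period; the section is then
    extended by translation. *)
Lemma periodic_section (N : nat -> nat) d r : 0 < r -> N 0 = 0 ->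
  (forall p, N (p + d) = N p + r) -> (forall p, N p.+1 <= (N p).+1) ->
  exists2 th : nat -> nat, forall m, N (th m) = m & forall m, th (m + r) = th m + d.
Proof.
move=> r_gt0 N0 ND N_step.
have ivt m p : m <= N p -> exists q, N q = m.
  elim: p => [|p IH] m_le; first by exists 0; lia.
  have [/IH//|m_gt] := leqP m (N p).
  by exists p.+1; have := N_step p; lia.
have [th thE] : exists th : nat -> nat, forall m, N (th m) = m %% r.
  suff /boolp.choice[th thE] : forall m, exists p, N p = m %% r by exists th.
  move=> m.
  apply: (ivt _ d); have := ND 0; rewrite add0n N0 => ->.
  exact/ltnW/ltn_pmod.
exists (fun m => th (m %% r) + m %/ r * d) => m.
  by rewrite (periodicDn ND) thE modn_mod addnC -divn_eq.
by rewrite modnDr divnDr // divnn r_gt0 mulnDl mul1n addnA.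
Qed.

Definition jumps n (c : Cn n) (p : nat) : nat := \sum_(q < p) (act c q < act c q.+1).

Definition rank n (c : Cn n) : nat := jumps c n.

Section Rank.
Variable n : nat.
Hypothesis n_ge3 : 3 <= n.
Implicit Types (p q k m : nat) (c d : Cn n).

Lemma jumps0 c : jumps c 0 = 0.
Proof. exact: big_ord0. Qed.

Lemma jumpsS c p : jumps c p.+1 = jumps c p + (act c p < act c p.+1).
Proof. exact: big_ord_recr. Qed.

Lemma jumps_step c p : jumps c p <= jumps c p.+1 <= (jumps c p).+1.
Proof. by rewrite jumpsS; lia. Qed.

Lemma jumpsD c p : jumps c (p + n) = jumps c p + rank c.
Proof.
elim: p => [|p IH]; first by rewrite jumps0.
by rewrite addSn !jumpsS IH -addSn !actD // ltn_add2r; lia.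
Qed.

Lemma jumps_homo c p q : p <= q -> jumps c p <= jumps c q.
Proof. by apply: homoS => x; have /andP[] := jumps_step c x. Qed.

Lemma jumps_lt c p q : (jumps c p < jumps c q) = (act c p < act c q).
Proof.
have f_step x : act c x <= act c x.+1 by apply: act_homo.
have g_step x : jumps c x <= jumps c x.+1 by have /andP[] := jumps_step c x.
by apply/idP/idP; apply: lt_jumps => // x; rewrite jumpsS; lia.
Qed.

Lemma jumps_eq c p q : jumps c p = jumps c q -> act c p = act c q.
Proof.
by have := jumps_lt c p q; have := jumps_lt c q p; move=> + + E; rewrite E ltnn; lia.
Qed.

Lemma jumps_unique c (N : nat -> nat) : N 0 = 0 ->
  (forall p, N p <= N p.+1 <= (N p).+1) ->
  (forall p, (N p < N p.+1) = (act c p < act c p.+1)) -> jumps c =1 N.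
Proof.
move=> N0 N_step N_jump; elim=> [|p IH]; first by rewrite jumps0.
by rewrite jumpsS IH -N_jump; have := N_step p; lia.
Qed.

Lemma rank_mull c d : rank (c * d)%g <= rank c.
Proof.
rewrite /rank /jumps; apply: leq_sum => p _; rewrite !act_mul //.
case: ltnP => //= lt_d; rewrite lt0b ltnNge; apply/negP => /(act_homo d).
by lia.
Qed.

(** If c d jumps at p, then d jumps somewhere between act c p and act c p.+1; the
    jumps of d from act c 0 to act c n = act c 0 + n add up to its rank. *)
Lemma rank_mulr c d : rank (c * d)%g <= rank d.
Proof.
have main p : jumps (c * d)%g p + jumps d (act c 0) <= jumps d (act c p).
  elim: p => [|p IH]; first by rewrite jumps0.
  rewrite jumpsS !act_mul // -jumps_lt.
  have := jumps_homo d (act_homo c (leqnSn p)); lia.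
have := main n; rewrite act_n // jumpsD /rank; lia.
Qed.

Lemma rank_mul3 c d e : rank (c * d * e)%g <= rank d.
Proof. exact: leq_trans (rank_mull _ _) (rank_mulr _ _). Qed.

Lemma rank1 : rank (1%g : Cn n) = n.
Proof.
rewrite /rank (@jumps_unique _ id) // => p; first by rewrite leqnSn leqnn.
by rewrite !act1.
Qed.

Lemma rank_gt0 c : 0 < rank c.
Proof. by rewrite /rank -(jumps0 c) jumps_lt act_n //; lia. Qed.

(** A nonempty word has a flat step ([walk_descent]), hence at most n - 1 jumps. *)
Lemma rank_full c : rank c = n -> c = 1%g.
Proof.
move=> rn; have : exists u, c = \pi_(Cn n)%qT u by elim/Cn_ind: c rn => u _; exists u.
case=> u cE; have [u0|/walk_descent[//|p [_]]] := eqVneq u [::]; first by rewrite cE u0.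
rewrite -!(act_pi n_ge3) -cE => eq_p.
have full q : q <= n -> jumps c (p.+1 + q) <= jumps c p.+1 + (q - 1).
  elim: q => [|q IH] q_le; first by rewrite addn0 leq_addr.
  rewrite addnS jumpsS; have [->|q_gt0] := posnP q; first by rewrite addn0 eq_p ltnn; lia.
  by have := IH; lia.
have := full n (leqnn n); rewrite jumpsD rn; lia.
Qed.

End Rank.

Section Factor.
Variables n i : nat.
Hypothesis n_ge3 : 3 <= n.
Hypothesis i_le : i <= n - 2.
Implicit Types (p q k m : nat) (a b c d : Cn n).

Local Notation r := (rk n i).
Local Notation lev := (lev n i).
Local Notation site := (site n i).
Local Notation x := (xq n i).

Lemma rank_xqXS k : rank (x ^+ k.+1)%g = r.
Proof.
have rE := rkE n_ge3 i_le.
rewrite /rank (jumps_unique n_ge3 (N := lev)) => [||p|p].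
- by rewrite (lev_small n_ge3 i_le) //; lia.
- by rewrite (lev_small n_ge3 i_le).
- exact: lev_leS.
by rewrite !act_xqX // site_lt // ltn_add2r.
Qed.

Lemma rank_xqX k : r <= rank (x ^+ k)%g.
Proof.
case: k => [|k]; last by rewrite rank_xqXS.
by rewrite expg0 rank1 //; have rE := rkE n_ge3 i_le; lia.
Qed.

(** An enumeration F of a periodic set with r points per period is x_n q_i to some
    power followed by an element of B_i: renumber F so that it starts at the first
    point >= i + 2 of the set.  To reach this point from F 0 one may have to go
    backwards, which is why F is first translated by a multiple of n. *)
Lemma Bset_factor (F : nat -> nat) : (forall m, F m < F m.+1) ->
  (forall m, F (m + r) = F m + n) -> i.+1 < F 0 ->
  exists b k, Bset n i b /\ forall m, F m = act b (site (m + k)).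
Proof.
move=> F_inc FD F0; have rE := rkE n_ge3 i_le; have r_gt0 := rk_gt0 n_ge3 i_le.
have F_lt : {homo F : p q / p < q} by apply: homo_ltn F_inc; apply: ltn_trans.
set L := F 0 in F0.
have FL m : F (m + L * r) = F m + L * n by apply: periodicDn.
have ex_j : exists j, L * n + i.+1 < F j.
  by exists (0 + L * r); rewrite FL -/L; lia.
case: (ex_minnP ex_j) => j Fj j_min.
have j_le : j <= L * r by apply: j_min; have := FL 0; rewrite add0n -/L; lia.
have j_gt0 : 0 < j by case: (posnP j) Fj => [->|//]; rewrite -/L; nia.
have Fj1 : F j.-1 <= L * n + i.+1.
  by rewrite leqNgt; apply/negP => /j_min; lia.
pose E m := F (j + m) - L * n.
have Fj_lt m : L * n + i.+1 < F (j + m).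
  by case: m => [|m]; [rewrite addn0|have := F_lt j (j + m.+1)]; lia.
have [|||b Bb bE] := Bset_ex n_ge3 i_le (E := E).
- by rewrite /E; have := Fj_lt 0; lia.
- rewrite /E; have -> : j + r.-1 = j.-1 + r by lia.
  by rewrite FD; lia.
- by move=> m; rewrite /E addnS; have := F_inc (j + m); have := Fj_lt m; lia.
exists b, (L * r - j); split=> // m.
have bE' t : act b (site t) = E t.
  elim/(@add_ind r): t => // t IH.
  rewrite siteD // actD // IH /E addnA FD.
  by have := Fj_lt t; lia.
rewrite bE' /E; have -> : j + (m + (L * r - j)) = m + L * r by lia.
by rewrite FL addnK.
Qed.

Lemma act_nf a k b p :
  act (a * x ^+ k.+1 * b)%g p = act b (site (lev (act a p) + k)).
Proof. by rewrite !act_mul // act_xqX. Qed.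

Lemma nf_jumps a k b : Aset n i a -> Bset n i b ->
  jumps (a * x ^+ k.+1 * b)%g =1 (fun p => lev (act a p)).
Proof.
move=> /AsetE[//|//|a0 a_id a_step] /BsetE[//|//|b_n b_inc b_max].
have sb : spreads i b by [].
apply: jumps_unique => // [|p|p].
- by rewrite a0 (lev_small n_ge3 i_le).
- by rewrite a_step andbT; apply: lev_homo => //; apply: act_homo.
rewrite !act_nf; have b_lt m m' : m < m' -> act b (site m) < act b (site m').
  apply: (homo_ltn ltn_trans (f := fun t => act b (site t))) => t.
  exact: spreads_site_ltS.
have lev_le : lev (act a p) <= lev (act a p.+1) by apply: lev_homo => //; apply: act_homo.
apply/idP/idP => [lt_lev|]; first by apply: b_lt; rewrite ltn_add2r.
apply: contraTT => le_nlev; have -> : lev (act a p) = lev (act a p.+1) by lia.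
by rewrite ltnn.
Qed.

Lemma nf_rank a k b : Aset n i a -> Bset n i b -> rank (a * x ^+ k.+1 * b)%g = r.
Proof.
move=> Aa Bb; rewrite /rank nf_jumps //; have [//|//|a0 _ _] := iffLR (AsetE _ _ _) Aa.
by rewrite (gathers_n n_ge3 a0) (lev_small n_ge3 i_le) // /rk; lia.
Qed.

Lemma act_xq_ge u v p : i.+1 < act (u * x * v)%g p.
Proof.
rewrite !act_mul //; apply: leq_trans (act_ge v _); rewrite act_xq //.
by apply: (@leq_trans (site 0)); rewrite ?site_le // site_small ?addn0 //; apply: rk_gt0.
Qed.

Lemma nf_0 a k b : i.+1 < act (a * x ^+ k.+1 * b)%g 0.
Proof. by rewrite expgS mulgA -(mulgA (a * x)%g) act_xq_ge. Qed.

(** The jumps of the product give back the levels of a, hence a.  The rest is the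
    enumeration m |-> act b (site (m + k)); continued to negative m, it takes its
    first value >= i + 2 at m = - k, which determines k. *)
Lemma nf_inj a k b a' k' b' : Aset n i a -> Bset n i b -> Aset n i a' -> Bset n i b' ->
  (a * x ^+ k.+1 * b)%g = (a' * x ^+ k'.+1 * b')%g -> [/\ a = a', k = k' & b = b'].
Proof.
move=> Aa Bb Aa' Bb' eq_nf; have rE := rkE n_ge3 i_le; have r_gt0 := rk_gt0 n_ge3 i_le.
have ga := iffLR (AsetE n_ge3 i_le a) Aa; have ga' := iffLR (AsetE n_ge3 i_le a') Aa'.
have sb := iffLR (BsetE n_ge3 i_le b) Bb; have sb' := iffLR (BsetE n_ge3 i_le b') Bb'.
have aa' : a = a'.
  apply: (gathers_inj n_ge3 i_le ga ga') => p _.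
  by rewrite -(nf_jumps k Aa Bb) eq_nf (nf_jumps k' Aa' Bb').
have bb' m : act b (site (m + k)) = act b' (site (m + k')).
  have [a0 _ a_step] := ga.
  have aD p : lev (act a (p + n)) = lev (act a p) + r by rewrite actD // levD.
  have [|th th1 _] := periodic_section r_gt0 _ aD a_step.
    by rewrite a0 (lev_small n_ge3 i_le).
  have := congr1 (fun c => act c (th m)) eq_nf.
  by rewrite !act_nf -aa' th1.
have actsD (c : Cn n) t : act c (site (t + r)) = act c (site t) + n.
  by rewrite siteD // actD.
(* If t < t', the value of c at n would be at least act c' (site 0) + n, which
   lies beyond n + i + 1. *)
have no_lt (c c' : Cn n) t t' : spreads i c -> spreads i c' ->
    (forall m, act c (site (m + t)) = act c' (site (m + t'))) -> t' <= t.
  move=> sc sc' cc'; rewrite leqNgt; apply/negP => lt_t.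
  have c_homo : {homo (fun m => act c' (site m)) : p q / p <= q}.
    by move=> p q pq; apply: act_homo; rewrite site_le.
  have [c_n _ _] := sc.
  have := cc' (t * r + r.-1 - t).
  have -> : t * r + r.-1 - t + t = r.-1 + t * r by nia.
  rewrite (periodicDn (f := fun m => act c (site m)) (actsD c)).
  rewrite site_small; last by lia.
  have -> : i.+2 + r.-1 = n by lia.
  have : act c' (site (r + t * r)) <= act c' (site (t * r + r.-1 - t + t')).
    by apply: c_homo; nia.
  rewrite (periodicDn (f := fun m => act c' (site m)) (actsD c')).
  have := actsD c' 0; rewrite add0n => ->.
  have : i.+1 < act c' (site 0).
    by rewrite site_small // addn0; apply: act_ge.
  by move: c_n; lia.
have kk' : k = k'.
  by apply/eqP; rewrite eqn_leq (no_lt b' b) ?(no_lt b b').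
split=> //; apply: (spreads_inj n_ge3 i_le sb sb') => m m_lt.
have := bb' (m + k * r - k); rewrite -kk'.
have -> : m + k * r - k + k = m + k * r by nia.
rewrite (periodicDn (f := fun m => act b (site m)) (actsD b)).
by rewrite (periodicDn (f := fun m => act b' (site m)) (actsD b')) => /addIn.
Qed.

(** Realise the counting map of the jumps of c by an element of A_i; what remains
    is the enumeration of the image of c. *)
Lemma nf_ex c : rank c = r -> i.+1 < act c 0 ->
  exists a b k, [/\ Aset n i a, Bset n i b & c = (a * x ^+ k.+1 * b)%g].
Proof.
move=> c_rank c0; have r_gt0 := rk_gt0 n_ge3 i_le.
have [||p _|a Aa aE] := Aset_ex n_ge3 i_le (N := jumps c).
- exact: jumps0.
- exact: c_rank.
- exact: jumps_step.
have cD p : jumps c (p + n) = jumps c p + r by rewrite jumpsD // c_rank.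
have [p|th th1 thD] := periodic_section r_gt0 (jumps0 c) cD.
  by have /andP[] := jumps_step n_ge3 c p.
have FE p : act c (th (jumps c p)) = act c p by apply: jumps_eq; rewrite // th1.
have [m|m||b [k [Bb bE]]] := @Bset_factor (fun m => act c (th m)).
- by rewrite -jumps_lt // !th1.
- by rewrite thD actD.
- by rewrite -(jumps0 c) FE.
exists a, b, k; split=> //; apply: (act_inj n_ge3) => p.
rewrite act_nf; have n_gt0 : 0 < n by lia.
have -> : lev (act a p) = jumps c p.
  elim/(@add_ind n): p => // [p p_lt|p IH]; first by apply: aE; lia.
  by rewrite actD // levD // IH cD.
by rewrite -bE FE.
Qed.

(** Multiplication by u on the left turns any counting map N with r jumps per
    period into [lev n i], up to a constant: u sends the level m to a point where
    N has the value m + k0.  The translation by (i + 2) n in the proof makes room for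
    a positive power of x_n q_i. *)
Lemma align (N : nat -> nat) : N 0 = 0 -> (forall p, N (p + n) = N p + r) ->
  (forall p, N p <= N p.+1 <= (N p).+1) ->
  exists (u : Cn n) (F : nat -> nat) k0, [/\ forall p, act u p = F (lev p),
    forall m, F (m + r) = F m + n, i.+1 < F 0 & forall m, N (F m) = m + k0].
Proof.
move=> N0 ND N_step; have r_gt0 := rk_gt0 n_ge3 i_le.
have [p|th th1 thD] := periodic_section r_gt0 N0 ND.
  by have /andP[] := N_step p.
have N_homo : {homo N : p q / p <= q} by apply: homoS => p; have /andP[] := N_step p.
pose F m := th m + i.+2 * n.
have NF m : N (F m) = m + i.+2 * r by rewrite /F (periodicDn ND) th1.
have [m|m||b [k [Bb bE]]] := @Bset_factor F.
- by rewrite ltnNge; apply/negP => /N_homo; rewrite !NF; lia.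
- by rewrite /F thD addnAC.
- by rewrite /F; nia.
exists (x ^+ k.+1 * b)%g, F, (i.+2 * r); split=> //.
- by move=> p; rewrite act_mul // act_xqX // bE.
- by move=> m; rewrite /F thD addnAC.
- by rewrite /F; nia.
Qed.

(** First align the jumps of c: u c = (x_n q_i)^k b with b in B_i.  Then chi_i b is
    in A_i, and aligning its jumps gives u' (chi_i b) x_n q_i = (x_n q_i)^l.  Now
    apply chi_i, which fixes x_n q_i, and multiply u c by chi_i u' on the right. *)
Lemma rank_divides c : r <= rank c -> exists u v k, (u * c * v)%g = (x ^+ k)%g.
Proof.
move=> c_rank; have r_gt0 := rk_gt0 n_ge3 i_le; have n_gt0 : 0 < n by lia.
(* The rank of c may exceed r: N counts only the first r jumps in each period. *)
pose N p := p %/ n * r + minn r (jumps c (p %% n)).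
have ND p : N (p + n) = N p + r.
  by rewrite /N modnDr divnDr // divnn n_gt0 mulnDl mul1n addnAC.
have N_lt p : p <= n -> N p = minn r (jumps c p).
  rewrite leq_eqVlt => /orP[/eqP->|p_lt]; last by rewrite /N divn_small // modn_small.
  have -> : N n = N 0 + r by rewrite -ND.
  by rewrite /N div0n mod0n jumps0 -/(rank c); lia.
have N0 : N 0 = 0 by rewrite N_lt // jumps0; lia.
have N_step p : N p <= N p.+1 <= (N p).+1 /\ (N p < N p.+1 -> act c p < act c p.+1).
  elim/(@add_ind n): p => // [p p_lt|p]; last by rewrite -addSn !ND !actD //; lia.
  by rewrite !N_lt ?(ltnW p_lt) // jumpsS; lia.
have N_imp p q : N p < N q -> act c p < act c q.
  by apply: lt_jumps => t; have := N_step t; have := act_homo c (leqnSn t); lia.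
have [p|u [F [k0 [uE FD F0 NF]]]] := align N0 ND; first by have [] := N_step p.
have [m|m||b [k [Bb bE]]] := @Bset_factor (fun m => act c (F m)).
- by apply: N_imp; rewrite !NF; lia.
- by rewrite FD actD.
- exact: leq_trans F0 (act_ge _ _).
have ucE : (u * c)%g = (x ^+ k.+1 * b)%g.
  by apply: (act_inj n_ge3) => p; rewrite !act_mul // uE bE act_xqX.
have ga := spreads_chi n_ge3 i_le (iffLR (BsetE n_ge3 i_le b) Bb).
set a := chi i b in ga; have [a0 _ a_step] := ga.
have [|p|p|u' [F' [k1 [u'E _ _ NF']]]] := @align (fun p => lev (act a p)).
- by rewrite a0 (lev_small n_ge3 i_le).
- by rewrite actD // levD.
- by rewrite a_step andbT; apply: lev_homo => //; apply: act_homo.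
have u'aE : (u' * a * x)%g = (x ^+ k1.+1)%g.
  by apply: (act_inj n_ge3) => p; rewrite !act_mul // act_xq // u'E NF' act_xqX.
have bu' : (x * b * chi i u')%g = (x ^+ k1.+1)%g.
  have := congr1 (@chi n i) u'aE.
  by rewrite !chiM chi_xqX // chi_xq // /a chiK mulgA.
exists u, (chi i u'), (k + k1.+1); rewrite ucE expgSr -!mulgA.
by rewrite [(x * _)%g]mulgA bu' -expgnDr.
Qed.

End Factor.

Local Open Scope classical_set_scope.

(** * The ideals and the matrix type *)

Lemma ideal_setT (T : monoidType) (I : set T) :
  ideal_of I [set: T] -> forall u c v, I c -> I (u * c * v)%g.
Proof.
move=> [_ idI] u c v Ic; have [_ Iuc] := idI u c Logic.I Ic.
by have [] := idI v (u * c)%g Logic.I (idI u c Logic.I Ic).1.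
Qed.

Lemma rees_mulA (T : monoidType) (I : set T) : ideal_of I [set: T] ->
  associative (rees_mul I).
Proof.
move=> [_ idI] [u|] [v|] [w|] //=; last by case: asboolP.
have Iuvw : I (v * w)%g \/ I (u * v)%g -> I (u * v * w)%g.
  case=> [/(idI u _ Logic.I)[Iu _]|/(idI w _ Logic.I)[_ //]].
  by rewrite -mulgA.
case: (asboolP (I (v * w)%g)) => [Ivw|_]; case: (asboolP (I (u * v)%g)) => [Iuv|_] //=.
- by case: asboolP => // -[]; apply: Iuvw; left.
- by rewrite mulgA; case: asboolP => // -[]; apply: Iuvw; right.
by rewrite mulgA.
Qed.

(** The map of c is determined by its values at 0, ..., n - 1, and these are at most
    act c n = act c 0 + n. *)
Lemma act_le_finite n (n_ge3 : 3 <= n) B : finite_set [set c : Cn n | act c 0 <= B].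
Proof.
have n_gt0 : 0 < n by lia.
pose bounded (c : Cn n) := act c 0 <= B.
pose f (c : Cn n) : {ffun 'I_n -> 'I_(B + n).+1} := [ffun p : 'I_n => inord (act c p)].
have f_inj c d : bounded c -> bounded d -> f c = f d -> c = d.
  move=> c_le d_le fcd; apply: (@act_inj_window _ n_ge3 0) => p p_lt.
  have act_lt (e : Cn n) : bounded e -> act e p < (B + n).+1.
    move=> e_le; have := act_homo e (_ : p <= n); rewrite act_n //.
    by rewrite /bounded in e_le; lia.
  have := congr1 (fun h : {ffun 'I_n -> 'I_(B + n).+1} => val (h (Ordinal p_lt))) fcd.
  by rewrite !ffunE /= !inordK ?act_lt.
have /boolp.choice[g gE] : forall h, exists c,
    (exists2 c', bounded c' & f c' = h) -> bounded c /\ f c = h.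
  move=> h; have [[c c_le fc]|no_c] := pselect (exists2 c', bounded c' & f c' = h).
    by exists c.
  by exists 1%g.
apply: (@sub_finite_set _ _ (g @` [set: _])); last exact/finite_image/finite_finset.
move=> c c_le; have [|g_le fg] := gE (f c); first by exists c.
by exists (f c) => //; apply: f_inj.
Qed.

Section Ideals.
Variables n i : nat.
Hypothesis n_ge3 : 3 <= n.
Hypothesis i_le : i <= n - 2.
Implicit Types (p q k m : nat) (a b c d : Cn n).

Local Notation r := (rk n i).
Local Notation lev := (lev n i).
Local Notation site := (site n i).
Local Notation x := (xq n i).

(** Powers of x_n q_i have rank at least r, and rank does not increase under
    multiplication; the converse is [rank_divides]. *)
Lemma Iset_rank c : Iset n i c <-> rank c < r.
Proof.
split=> [c_I|c_rank].
  rewrite ltnNge; apply/negP => /(rank_divides n_ge3 i_le)[u [v [k ucv]]].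
  have : (two_sided c `&` powers x) (x ^+ k)%g by split; [exists u, v|exists k].
  by rewrite c_I.
apply/seteqP; split=> // _ [[u [v ->]] [k _ ucv]].
have := rank_xqX n_ge3 i_le k; rewrite ucv leqNgt => /negP; apply.
exact: leq_ltn_trans (rank_mul3 n_ge3 u c v) c_rank.
Qed.

Lemma Iset_ideal : ideal_of (Iset n i) [set: Cn n].
Proof.
split=> // u c _ /Iset_rank c_I; split; apply/Iset_rank; apply: leq_ltn_trans c_I.
  exact: rank_mulr.
exact: rank_mull.
Qed.

Lemma Mtilde_rank c : Mtilde n i c <-> rank c = r /\ i.+1 < act c 0.
Proof.
split=> [[a [b [[|k] [//Aa Bb _ ->]]]]|[c_rank c0]].
  by split; [apply: nf_rank|apply: nf_0].
have [a [b [k [Aa Bb ->]]]] := nf_ex n_ge3 i_le c_rank c0.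
by exists a, b, k.+1.
Qed.

Lemma Iset_chi c : Iset n i c -> Iset n i (chi i c).
Proof.
move=> c_I; apply/seteqP; split=> // _ [[u [v ->]] [k _ ucv]].
suff : (two_sided c `&` powers x) (x ^+ k)%g by rewrite c_I.
split; last by exists k.
exists (chi i v), (chi i u).
by have := congr1 (@chi n i) ucv; rewrite chi_xqX // !chiM chiK mulgA.
Qed.

Lemma xqX_inj k k' : (x ^+ k.+1)%g = (x ^+ k'.+1)%g -> k = k'.
Proof.
move/(congr1 (fun c => act c 0)); rewrite !act_xqX // => /(site_inj n_ge3 i_le).
exact: addnI.
Qed.

(** The product h maps the level m to the site number Q m, so it jumps only where
    [lev n i] does.  If its rank is r it jumps at all these points, hence Q is
    strictly increasing; as Q (m + r) = Q m + r, it is a translation. *)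
Lemma sandwich c : ~ Iset n i (x * c * x)%g -> exists k, (x * c * x)%g = (x ^+ k.+2)%g.
Proof.
set h := (x * c * x)%g; move=> /Iset_rank/negP; rewrite -leqNgt => h_rank.
have r_gt0 := rk_gt0 n_ge3 i_le; have n_gt0 : 0 < n by lia.
pose Q m := lev (act c (site m)).
have hE p : act h p = site (Q (lev p)) by rewrite /h !act_mul // !act_xq.
have h_rankE : rank h = r.
  apply/eqP; rewrite eqn_leq h_rank andbT.
  by apply: leq_trans (rank_mulr n_ge3 _ _) _; rewrite -(rank_xqXS n_ge3 i_le 0) expg1.
have h_step p : jumps h p.+1 <= jumps h p + (lev p.+1 - lev p).
  rewrite jumpsS !hE; have /andP[le_lev _] := lev_leS n_ge3 i_le p.
  case: ltnP => /=; last by lia.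
  have [lt_lev|] := ltnP (lev p) (lev p.+1); first by lia.
  by move=> ge_lev; have -> : lev p = lev p.+1 by [lia]; rewrite ltnn.
have lev0 : lev 0 = 0 by rewrite (lev_small n_ge3 i_le).
have h_lev p : jumps h p = lev p.
  have slope q t : jumps h (q + t) + lev q <= jumps h q + lev (q + t).
    elim: t => [|t IH]; first by rewrite addn0.
    rewrite addnS; have := h_step (q + t).
    by have /andP[] := lev_leS n_ge3 i_le (q + t); lia.
  apply/eqP; rewrite eqn_leq; apply/andP; split.
    by have := slope 0 p; rewrite add0n jumps0 lev0; lia.
  have := slope p (p * n - p).
  have -> : p + (p * n - p) = 0 + p * n by nia.
  rewrite (levDn n_ge3 i_le) (periodicDn (fun q => jumpsD n_ge3 h q)) h_rankE jumps0 lev0.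
  by lia.
have [p|th thE _] := periodic_section r_gt0 lev0 (levD n_ge3 i_le).
  by have /andP[] := lev_leS n_ge3 i_le p.
have Q_inc m : Q m < Q m.+1.
  have := jumps_lt n_ge3 h (th m) (th m.+1).
  by rewrite !hE !h_lev !thE site_lt // ltnSn => <-.
have QD m : Q (m + r) = Q m + r by rewrite /Q siteD // actD // levD.
have Q_grow m t : Q m + t <= Q (m + t).
  by elim: t => [|t IH]; [rewrite !addn0|have := Q_inc (m + t); rewrite !addnS; lia].
have QE m : Q m = Q 0 + m.
  apply/eqP; rewrite eqn_leq andbC; have -> /= : Q 0 + m <= Q m by rewrite -{2}[m]add0n.
  have := Q_grow m (m * r - m); have -> : m + (m * r - m) = 0 + m * r by nia.
  by rewrite (periodicDn QD); nia.
have Q0 : 0 < Q 0.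
  rewrite /Q -(lev_site n_ge3 i_le 0); apply: leq_trans (_ : lev (site 0) <= _) => //.
  by apply: lev_homo => //; apply: act_ge.
exists (Q 0).-1; apply: (act_inj n_ge3) => p.
by rewrite hE act_xqX // QE prednK // addnC.
Qed.

Lemma act0_mul u c v : i.+1 < act c 0 -> i.+1 < act (u * c * v)%g 0.
Proof.
move=> c0; rewrite !act_mul //; apply: leq_trans c0 _; apply: leq_trans (act_ge v _).
exact: act_homo.
Qed.

Lemma Mtilde_notI c : Mtilde n i c -> ~ Iset n i c.
Proof. by case/Mtilde_rank => c_rank _ /Iset_rank; rewrite c_rank ltnn. Qed.

Lemma Mtilde_or_I u c v : Mtilde n i c -> Iset n i (u * c * v)%g \/ Mtilde n i (u * c * v)%g.
Proof.
case/Mtilde_rank => c_rank c0; have := rank_mul3 n_ge3 u c v; rewrite c_rank leq_eqVlt.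
case/orP => [/eqP ucv_rank|/Iset_rank]; last by left.
by right; apply/Mtilde_rank; split=> //; apply: act0_mul.
Qed.

Lemma Mset_semigroup : is_semigroup (Mset n i) (rees_mul (Iset n i)).
Proof.
split=> [_ _ [->|[u Mu <-]] [->|[w Mw <-]]|*]; try by left.
  rewrite /=; case: asboolP => [_|uw_I]; first by left.
  by right; exists (u * w)%g => //; have := Mtilde_or_I 1%g w Mu; rewrite mul1g; case.
exact/rees_mulA/Iset_ideal.
Qed.

Lemma chi_bij : set_bij (Aset n i) (Bset n i) (@chi n i).
Proof.
split=> [c /(AsetE n_ge3 i_le) gc|c d _ _ /(can_inj (@chiK n i))//|c].
  by apply/BsetE => //; apply: gathers_chi.
move=> /(BsetE n_ge3 i_le) sc; exists (chi i c); last exact: chiK.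
by apply/AsetE => //; apply: spreads_chi.
Qed.

(** The entry of P at (b, a) is the power with exponent e such that
    x_n q_i b a x_n q_i is the power with exponent e + 2, and the zero if this
    product lies in I_i.  Since chi_i fixes x_n q_i and exchanges (chi_i a) a' and
    (chi_i a') a, the matrix is symmetric.  The isomorphism reads off the normal
    form. *)
Lemma Mset_matrix_type : exists P : Cn n -> Cn n -> option (Cn n),
  [/\ forall b a, Bset n i b -> Aset n i a -> adj0 (powers x) (P b a),
      forall a a', Aset n i a -> Aset n i a' -> P (chi i a) a' = P (chi i a') a &
      semigroup_iso (Mset n i) (rees_mul (Iset n i))
        (matrix_type (pos_powers x) (Aset n i) (Bset n i)) (matrix_mul P)].
Proof.
have /boolp.choice[e eE] : forall c, exists k,
    ~ Iset n i (x * c * x)%g -> (x * c * x)%g = (x ^+ k.+2)%g.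
  move=> c; have [xcx_I|/sandwich[k xcx]] := pselect (Iset n i (x * c * x)%g).
    by exists 0.
  by exists k.
pose P b a := if `[< Iset n i (x * (b * a) * x)%g >] then None
              else Some (x ^+ e (b * a)%g)%g.
have nfP c : exists t : Cn n * nat * Cn n, Mtilde n i c ->
    [/\ Aset n i t.1.1, Bset n i t.2 & c = (t.1.1 * x ^+ t.1.2.+1 * t.2)%g].
  have [Mc|nMc] := pselect (Mtilde n i c); last by exists (1%g, 0, 1%g).
  case: Mc (Mc) => a [b [[|k] [//Aa Bb _ cE]]] Mc.
  by exists (a, k, b).
have /boolp.choice[t tE] := nfP.
pose f o := if o is Some c then Some ((x ^+ (t c).1.2.+1)%g, (t c).1.1, (t c).2) else None.
have t_nf a k b : Aset n i a -> Bset n i b -> t (a * x ^+ k.+1 * b)%g = (a, k, b).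
  move=> Aa Bb; have [|] := tE (a * x ^+ k.+1 * b)%g; first by exists a, b, k.+1.
  case: (t _) => -[a' k'] b' /= Aa' Bb' E.
  by have [-> -> ->] := nf_inj n_ge3 i_le Aa Bb Aa' Bb' E.
exists P; split.
- move=> b a _ _; rewrite /P; case: asboolP => _; first by left.
  by right; exists (x ^+ e (b * a)%g)%g => //; exists (e (b * a)%g).
- move=> a a' _ _; rewrite /P.
  have chi_x c : chi i (x * c * x)%g = (x * chi i c * x)%g by rewrite !chiM chi_xq // mulgA.
  have cE : (chi i a' * a = chi i (chi i a * a'))%g by rewrite chiM chiK.
  set c := (chi i a * a')%g in cE *; rewrite cE -chi_x.
  case: asboolP => c_I; case: asboolP => chi_I //.
  + by case: chi_I; apply: Iset_chi.
  + by case: c_I; rewrite -[(x * c * x)%g](@chiK n i); apply: Iset_chi.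
  have E1 := eE _ c_I; have := eE (chi i c); rewrite -chi_x => /(_ chi_I).
  by rewrite E1 chi_xqX // => /xqX_inj[->].
exists f; split; first split.
- move=> _ [->|[c Mc <-]]; first by left.
  have [At Bt _] := tE c Mc; right; eexists; last by [].
  by split=> //; split=> //; exists (t c).1.2.+1.
- move=> o o' /set_mem Mo /set_mem Mo'.
  case: Mo => [->|[c Mc <-]]; case: Mo' => [->|[c' Mc' <-]] //= -[xE aE bE].
  have [_ _ cE] := tE c Mc; have [_ _ cE'] := tE c' Mc'.
  by rewrite cE cE' xE aE bE.
- move=> _ [->|[[[s a] b] [[[k k_gt0 /= <-] Aa] Bb] <-]]; first by exists None => //; left.
  case: k k_gt0 => // k _; exists (Some (a * x ^+ k.+1 * b)%g).
    by right; exists (a * x ^+ k.+1 * b)%g => //; exists a, b, k.+1.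
  by rewrite /f t_nf.
move=> _ _ [->|[c Mc <-]] [->|[c' Mc' <-]] //.
have [Aa Bb cE] := tE c Mc; have [Aa' Bb' cE'] := tE c' Mc'.
rewrite /f /=.
move: (t c) (t c') Aa Bb cE Aa' Bb' cE' => [[a k] b] [[a' k'] b'] /= Aa Bb -> Aa' Bb' ->.
have prodE : ((a * x ^+ k.+1 * b) * (a' * x ^+ k'.+1 * b') =
    a * x ^+ k * (x * (b * a') * x) * (x ^+ k' * b'))%g.
  by rewrite expgSr expgS !mulgA.
rewrite /P; case: (asboolP (Iset n i (x * (b * a') * x)%g)) => [ba_I|/eE ba_e].
  rewrite prodE; case: asboolP => // -[].
  exact: (ideal_setT Iset_ideal).
have prodE' : ((a * x ^+ k.+1 * b) * (a' * x ^+ k'.+1 * b') =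
    a * x ^+ (k + (e (b * a')%g).+2 + k').-1.+1 * b')%g.
  rewrite prodE ba_e prednK; last by lia.
  by rewrite !expgnDr !mulgA.
case: asboolP => [prod_I|_].
  case: (@Mtilde_notI _ _ prod_I); rewrite prodE'.
  by exists a, b', (k + (e (b * a')%g).+2 + k').-1.+1.
rewrite prodE' t_nf //=; congr (Some (_, _, _)).
by rewrite -!expgnDr; congr (_ ^+ _)%g; lia.
Qed.

End Ideals.

Lemma finite_Some n (X : set (option (Cn n))) B : 3 <= n ->
  (forall o, X o -> o = None \/ exists2 c, act c 0 <= B & o = Some c) -> finite_set X.
Proof.
move=> n_ge3 XB; apply: (@sub_finite_set _ _ (adj0 [set c : Cn n | act c 0 <= B])).
  by move=> o /XB[->|[c c_le ->]]; [left|right; exists c].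
rewrite /adj0 finite_setU; split; first exact: finite_set1.
exact/finite_image/act_le_finite.
Qed.

(** * The chain of ideals *)

Section Chain.
Variable n : nat.
Hypothesis n_ge3 : 3 <= n.
Implicit Types (c u v : Cn n).

Lemma Iset_m1_ideal : ideal_of (Iset_m1 n) [set: Cn n].
Proof.
have [_ I_ideal] := Iset_ideal n_ge3 (leq0n (n - 2)).
split=> // u c _ [/(I_ideal u _ Logic.I)[? ?]|[v [w ->]]].
  by split; left.
split; right; first by exists (u * v)%g, w; rewrite !mulgA.
by exists v, (w * u)%g; rewrite !mulgA.
Qed.

Lemma Iset_pred_sub i : i <= n - 2 -> Iset n i `<=` Iset_pred n i.
Proof.
case: i => [|i] i_le c; first by left.
move=> /(Iset_rank n_ge3 i_le) c_rank; apply/Iset_rank => //; first by lia.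
by move: c_rank; rewrite /rk; lia.
Qed.

Lemma Mtilde_pred i : i <= n - 2 -> Mtilde n i `<=` Iset_pred n i.
Proof.
case: i => [|i] i_le c.
  case=> a [b [[|k] [//Aa Bb _ ->]]]; right.
  by exists (a * xq n 0 ^+ k)%g, b; rewrite expgSr !mulgA.
case/(Mtilde_rank n_ge3 i_le) => c_rank _; apply/Iset_rank => //; first by lia.
by rewrite c_rank /rk; lia.
Qed.

(** A multiple of x_n q_0 outside I_0 has rank n - 1 and maps 0 to at least 2. *)
Lemma Iset_m1_diff : Iset_m1 n `\` Iset n 0 = Mtilde n 0.
Proof.
apply/seteqP; split=> [c [[//|[u [v cE]]] c_nI]|c Mc]; last first.
  by split; [apply: (@Mtilde_pred 0)|apply: Mtilde_notI Mc].
have Mx : Mtilde n 0 (xq n 0).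
  apply/Mtilde_rank => //; split; first by rewrite -[xq n 0]expg1 rank_xqXS.
  by have := act_xq_ge n_ge3 (leq0n _) 1%g 1%g 0; rewrite mul1g mulg1.
by have [|] := Mtilde_or_I n_ge3 (leq0n _) u v Mx; rewrite -cE.
Qed.

Lemma Iset_pred_rank i c : i <= n - 2 -> Iset_pred n i c -> rank c <= rk n i.
Proof.
case: i => [|i] i_le; last first.
  by move=> /(Iset_rank n_ge3 (ltnW i_le)); rewrite /rk; lia.
case=> [/(Iset_rank n_ge3 i_le)/ltnW//|[u [v ->]]].
apply: leq_trans (rank_mul3 n_ge3 _ _ _) _.
by rewrite -[xq n 0]expg1 rank_xqXS.
Qed.

End Chain.

Theorem corollary3p25 (n : nat) (n_ge3 : 3 <= n) :
  [/\ (* the chain of ideals *)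
      [/\ Iset n (n - 2) = set0,
          forall i, i <= n - 2 -> ideal_of (Iset n i) [set: Cn n],
          forall i, i <= n - 2 -> ideal_of (Iset n i) (Iset_pred n i) &
          ideal_of (Iset_m1 n) [set: Cn n]],
      (* 1 *)
      forall i, i <= n - 2 ->
        [/\ is_semigroup (Mset n i) (rees_mul (Iset n i)),
            Mset n i `<=` rees (Iset_pred n i) (Iset n i),
            set_bij (Aset n i) (Bset n i) (@chi n i) &
            exists P : Cn n -> Cn n -> option (Cn n),
              [/\ forall b a, Bset n i b -> Aset n i a ->
                    adj0 (powers (xq n i)) (P b a),
                  forall a a', Aset n i a -> Aset n i a' ->
                    P (chi i a) a' = P (chi i a') a &
                  semigroup_iso
                    (Mset n i) (rees_mul (Iset n i))
                    (matrix_type (pos_powers (xq n i)) (Aset n i) (Bset n i))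
                    (matrix_mul P)]],
      (* 2 *)
      forall i, 1 <= i <= n - 2 ->
        finite_set (rees (Iset_pred n i) (Iset n i) `\` Mset n i),
      (* 3 *)
      rees (Iset_m1 n) (Iset n 0) = Mset n 0 &
      (* 4 and 5 *)
      ideal_of (Mtilde n (n - 2)) [set: Cn n] /\
      (is_semigroup (rees [set: Cn n] (Iset_m1 n)) (rees_mul (Iset_m1 n)) /\
       finite_set (rees [set: Cn n] (Iset_m1 n)))].
Proof.
have rk_last : rk n (n - 2) = 1 by rewrite /rk; lia.
have last_le := leqnn (n - 2).
have I_last c : ~ Iset n (n - 2) c.
  by move=> /(Iset_rank n_ge3 last_le); rewrite rk_last; have := rank_gt0 n_ge3 c; lia.
split.
- split.
  + by apply/seteqP; split=> // c /I_last.
  + by move=> i i_le; apply: Iset_ideal.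
  + move=> i i_le; split; first exact: Iset_pred_sub.
    by move=> u c _; have [_] := Iset_ideal n_ge3 i_le; apply.
  + exact: Iset_m1_ideal.
- move=> i i_le; split.
  + exact: Mset_semigroup.
  + move=> _ [->|[c Mc <-]]; first by left.
    by right; exists c => //; split; [apply: Mtilde_pred|apply: Mtilde_notI].
  + exact: chi_bij.
  + exact: Mset_matrix_type.
- move=> i /andP[_ i_le]; apply: (@finite_Some n _ i.+1 n_ge3) => o [].
  case=> [->|[c [c_pred c_I] <-] c_M]; first by left.
  right; exists c => //; rewrite leqNgt; apply/negP => c0; apply: c_M; right.
  exists c => //; apply/Mtilde_rank => //; split=> //.
  apply/eqP; rewrite eqn_leq Iset_pred_rank //= leqNgt.
  by apply/negP => c_rank; apply/c_I/Iset_rank.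
- by rewrite /rees Iset_m1_diff.
split.
  split=> // u c _ Mc.
  have [] := @Mtilde_or_I n (n - 2) n_ge3 last_le u c 1%g Mc; first by move/I_last.
  have [] := @Mtilde_or_I n (n - 2) n_ge3 last_le 1%g c u Mc; first by move/I_last.
  by rewrite mulg1 mul1g.
split.
  split=> [_ _ [->|[u [_ Iu] <-]] [->|[w [_ Iw] <-]]|*]; try by left.
    by rewrite /=; case: asboolP => [_|uw_I]; [left|right; exists (u * w)%g].
  exact/rees_mulA/Iset_m1_ideal.
apply: (@finite_Some n _ 1 n_ge3) => o [->|[c [_ c_I] <-]]; first by left.
right; exists c => //; rewrite leqNgt; apply/negP => c0; apply: c_I.
have [c_full|c_nfull] := eqVneq (rank c) n.
  by move: c0; rewrite (rank_full n_ge3 c_full) act1.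
have [/eqP c_rank|c_rank] := eqVneq (rank c) (rk n 0).
  by apply: (@Mtilde_pred n n_ge3 0) => //; apply/Mtilde_rank => //; split=> //; apply/eqP.
left; apply/Iset_rank => //; rewrite ltn_neqAle c_rank /=.
have : rank c <= n by rewrite -[X in _ <= X](rank1 n_ge3) -[c]mul1g rank_mull.
by rewrite /rk; lia.
Qed.
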